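(* Let $\overline{\,\cdot\,}$ be a continuous antilinear involution on $V$. The topology on $\mathcal{S}^\bullet(V)$ is the coarsest locally convex topology on the vector space of symmetric tensors over $V$ that makes all star products $\star_\Lambda$, for all continuous and Hermitian bilinear forms $\Lambda$ on $V$, as well as the $^*$-involution and the projection $\langle\cdot\rangle_0$ onto the scalars continuous. In addition, for all $X,Y\in\mathcal{S}^\bullet(V)$ and all $\langle\cdot|\cdot\rangle_\alpha\in\mathcal{I}_V$, $$\langle X^*\star_{\Lambda_\alpha}Y\rangle_0=\langle X|Y\rangle_\alpha^\bullet ,$$ where $\Lambda_\alpha$ is the continuous Hermitian bilinear form $\Lambda_\alpha(v,w):=\langle\overline{v}\,|\,w\rangle_\alpha$ on $V$.
   Context: $V$ is a complex Hausdorff locally convex space whose topology is given by its continuous Hilbert seminorms: let $\mathcal{I}_V$ be the set of continuous positive Hermitian forms $\langle\cdot\,|\,\cdot\rangle_\alpha$ on $V$ (sesquilinear, antilinear in the first argument, Hermitian, positive semi-definite), put $\|v\|_\alpha:=\sqrt{\langle v|v\rangle_\alpha}$, and let $\mathcal{P}_V$ be the set of all these seminorms; it is assumed that $\mathcal{P}_V$ is cofinal in the set of all continuous seminorms on $V$. Let $\mathcal{T}^k_{\mathrm{alg}}(V)$ be the algebraic $k$-th tensor power ($\mathcal{T}^0_{\mathrm{alg}}(V)=\mathbb{C}$), $\mathcal{T}^\bullet_{\mathrm{alg}}(V)=\bigoplus_{k\ge 0}\mathcal{T}^k_{\mathrm{alg}}(V)$, and $\langle X\rangle_k$ the degree-$k$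 component of $X$. Each $\langle\cdot|\cdot\rangle_\alpha\in\mathcal{I}_V$ is extended to a positive Hermitian form $\langle X|Y\rangle_\alpha^\bullet:=\sum_{k}\langle\langle X\rangle_k|\langle Y\rangle_k\rangle_\alpha^\bullet$ on $\mathcal{T}^\bullet_{\mathrm{alg}}(V)$, where $\langle x_1\otimes\cdots\otimes x_k|y_1\otimes\cdots\otimes y_k\rangle_\alpha^\bullet:=k!\prod_{m=1}^k\langle x_m|y_m\rangle_\alpha$; set $\|X\|_\alpha^\bullet:=\sqrt{\langle X|X\rangle_\alpha^\bullet}$. $\mathcal{T}^\bullet(V)$ is $\mathcal{T}^\bullet_{\mathrm{alg}}(V)$ with the locally convex topology defined by all seminorms $\|\cdot\|_\alpha^\bullet$, $\|\cdot\|_\alpha\in\mathcal{P}_V$. Let $\mathrm{Sym}^\bullet$ be the symmetrisation operator, $\mathrm{Sym}^\bullet(x_1\otimes\cdots\otimes x_k)=\frac1{k!}\sum_{\sigma\in\mathfrak{S}_k}x_{\sigma(1)}\otimes\cdots\otimes x_{\sigma(k)}$, and let $\mathcal{S}^\bullet(V)$ be its image (the symmetric tensors) with the subspace topology. For a continuous bilinear form $\Lambda$ on $V$, let $P_\Lambda$ be the linear endomorphism of $\mathcal{T}^\bullet(V)\otimes\mathcal{T}^\bullet(V)$ (outer tensor product) with $P_\Lambda\big((x_1\otimes\cdots\otimes x_k)\otimes(y_1\otimes\cdots\otimes y_\ell)\big)=k\ell\,\Lambda(x_k,y_1)\,(x_1\otimes\cdots\otimes x_{k-1})\otimes(y_2\otimes\cdots\otimes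 y_\ell)$ for $k,\ell\ge1$, and zero if $k=0$ or $\ell=0$ (the tensor sign between the two brackets is the outer one). With $\mu_\vee(X\otimes Y):=\mathrm{Sym}^\bullet(X\otimes Y)$ (product in the tensor algebra on the right), $X\star_\Lambda Y:=\sum_{t=0}^\infty\frac1{t!}\mu_\vee\big((P_\Lambda)^t(X\otimes Y)\big)$ for $X,Y\in\mathcal{S}^\bullet(V)$. The $^*$-involution is the antilinear map with $(x_1\otimes\cdots\otimes x_k)^*:=\overline{x_k}\otimes\cdots\otimes\overline{x_1}$ (complex conjugation on scalars), restricted to symmetric tensors. A bilinear form $\Lambda$ is Hermitian if $\Lambda(v,w)=\overline{\Lambda(\overline{w},\overline{v})}$ for all $v,w\in V$. *)

(* Defs.v *)
From HB Require Import structures.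
From mathcomp Require Import all_boot all_order all_algebra perm.
From mathcomp Require Import finmap complex monalg ring.
From mathcomp Require Import all_classical all_reals topology normedtype convex.

Set Implicit Arguments.
Unset Strict Implicit.
Unset Printing Implicit Defensive.

Import Order.TTheory GRing.Theory Num.Theory Num.Def.
Import numFieldNormedType.Exports.

Local Open Scope classical_set_scope.
Local Open Scope ring_scope.
Local Open Scope quotient_scope.

Section LinearSpan.
Variables (K : nzRingType) (E : lmodType K) (rel : set E).

Definition lspan : {pred E} := fun x =>
  `[< forall U : {pred E}, submod_closed U -> (forall y, rel y -> y \in U) ->
      x \in U >].

Lemma lspan_submod_closed : submod_closed lspan.
Proof.
split; first by apply/asboolP => U [].
move=> a x y /asboolP xs /asboolP ys; apply/asboolP => U UP relU.
by case: (UP) => _; apply; [exact: xs|exact: ys].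
Qed.

HB.instance Definition _ :=
  GRing.isSubmodClosed.Build K E lspan lspan_submod_closed.

Lemma mem_lspan x : rel x -> x \in lspan.
Proof. by move=> rx; apply/asboolP => U _; apply. Qed.

End LinearSpan.

(* The vector space with generators in T and linear relations in rel: the     *)
(* quotient of the free vector space {malg K[T]} by the span of rel.          *)
Section Presented.
Variables (K : nzRingType) (T : choiceType) (rel : set {malg K[T]}).

Definition presented : Type :=
  Quotient.quot (lspan rel : zmodClosed {malg K[T]}).
HB.instance Definition _ := EqQuotient.on presented.
HB.instance Definition _ := GRing.Zmodule.on presented.

Definition pclass (g : {malg K[T]}) : presented := \pi_presented g.

Lemma pclass_eq g1 g2 : (pclass g1 == pclass g2) = (g1 - g2 \in lspan rel).
Proof. by rewrite /pclass piE. Qed.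

Lemma pclass_repr X : pclass (repr X) = X.
Proof. exact: reprK. Qed.

Lemma pclassD g1 g2 : pclass (g1 + g2) = pclass g1 + pclass g2.
Proof. by rewrite /pclass !piE. Qed.

Lemma repr_pclass g : repr (pclass g) - g \in lspan rel.
Proof. by rewrite -pclass_eq pclass_repr. Qed.

Definition pscale (a : K) (X : presented) : presented := pclass (a *: repr X).

Lemma pscaleE a g : pscale a (pclass g) = pclass (a *: g).
Proof. by apply/eqP; rewrite pclass_eq -scalerBr rpredZ// repr_pclass. Qed.

Lemma pscaleA a b X : pscale a (pscale b X) = pscale (a * b) X.
Proof. by rewrite -(pclass_repr X) !pscaleE scalerA. Qed.

Lemma pscale1 : left_id 1 pscale.
Proof. by move=> X; rewrite -(pclass_repr X) !pscaleE scale1r. Qed.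

Lemma pscaleDr : right_distributive pscale +%R.
Proof.
move=> a X Y; rewrite -(pclass_repr X) -(pclass_repr Y).
by rewrite -pclassD !pscaleE -pclassD scalerDr.
Qed.

Lemma pscaleDl X : {morph pscale^~ X : a b / a + b}.
Proof.
by move=> a b; rewrite -(pclass_repr X) !pscaleE -pclassD scalerDl.
Qed.

HB.instance Definition _ := GRing.Zmodule_isLmodule.Build K presented
  pscaleA pscale1 pscaleDr pscaleDl.

Lemma pclass_is_linear : linear pclass.
Proof. by move=> a g1 g2; rewrite pclassD -pscaleE. Qed.

HB.instance Definition _ :=
  GRing.isLinear.Build K {malg K[T]} presented *:%R pclass pclass_is_linear.

End Presented.

HB.lock Definition gen (K : nzRingType) (T : choiceType)
    (rel : set {malg K[T]}) (k : T) : presented rel := pclass rel << k >>.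

Lemma genE (K : nzRingType) (T : choiceType) (rel : set {malg K[T]}) k :
  gen rel k = pclass rel << k >>.
Proof. by rewrite gen.unlock. Qed.

Definition free_ext (K : nzRingType) (T : choiceType) (W : lmodType K)
    (th : K -> K) (f : T -> W) (g : {malg K[T]}) : W :=
  \sum_(k <- msupp g) th g@_k *: f k.

(* The th-linear map out of the presented space whose value at the generator  *)
(* k is f k. It is computed on a representative, so it is meaningful (see     *)
(* lift_gen and lift_semilinear) when f is compatible with the relations.     *)
HB.lock Definition lift (K : nzRingType) (T : choiceType)
    (rel : set {malg K[T]}) (W : lmodType K) (th : K -> K) (f : T -> W)
    (X : presented rel) : W := free_ext th f (repr X).

Section Lift.
Variables (K : nzRingType) (T : choiceType) (rel : set {malg K[T]}).
Variables (W : lmodType K).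

Variable (th : {rmorphism K -> K}).

Lemma free_extEw (f : T -> W) (d : {fset T}) g : (msupp g `<=` d)%fset ->
  free_ext th f g = \sum_(k <- d) th g@_k *: f k.
Proof.
move=> gd; apply: big_fset_incl => // k _ /mcoeff_outdom ->.
by rewrite rmorph0 scale0r.
Qed.

Lemma free_ext_semilinear (f : T -> W) :
  GRing.linear_for (th \; *:%R) (free_ext th f).
Proof.
move=> a g1 g2; pose d := (msupp g1 `|` msupp g2)%fset.
have d1 : (msupp g1 `<=` d)%fset by rewrite fsubsetUl.
have d2 : (msupp g2 `<=` d)%fset by rewrite fsubsetUr.
have d3 : (msupp (a *: g1 + g2) `<=` d)%fset.
  apply: fsubset_trans (msuppD_le _ _) _.
  by rewrite fsetSU// msuppZ_le.
rewrite !(free_extEw f (d := d))// /= scaler_sumr -big_split/=.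
apply: eq_bigr => k _.
by rewrite mcoeffD mcoeffZ rmorphD rmorphM scalerDl scalerA.
Qed.

Lemma free_ext_gen (f : T -> W) k : free_ext th f << k >> = f k.
Proof.
rewrite (@free_extEw _ [fset k]%fset) ?msuppU_le// big_seq_fset1.
by rewrite mcoeffUU rmorph1 scale1r.
Qed.

Definition respects (f : T -> W) := forall r, rel r -> free_ext th f r = 0.

Lemma lift_pclass f g : respects f -> lift th f (pclass rel g) = free_ext th f g.
Proof.
rewrite lift.unlock => fr; have lin := free_ext_semilinear f.
have f0 : free_ext th f 0 = 0 by rewrite /free_ext msupp0 big_nil.
suff K0 x : x \in lspan rel -> free_ext th f x = 0.
  have /= := lin 1 (repr (pclass rel g) - g) g.
  by rewrite scale1r subrK (K0 (_ - _)) ?repr_pclass// scaler0 add0r.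
move=> /asboolP /(_ [pred x | free_ext th f x == 0]) => /(_ _ _)/eqP; apply.
  split; first by rewrite inE f0.
  by move=> a u v; rewrite !inE lin => /eqP-> /eqP->; rewrite /= scaler0 addr0.
by move=> y ry; rewrite inE fr.
Qed.

Lemma lift_gen f k : respects f -> lift th f (gen rel k) = f k.
Proof. by move=> fr; rewrite genE lift_pclass// free_ext_gen. Qed.

Lemma lift_semilinear f : respects f ->
  GRing.linear_for (th \; *:%R) (@lift K T rel W th f).
Proof.
move=> fr a X Y; rewrite -(pclass_repr X) -(pclass_repr Y) -linearP.
by rewrite !lift_pclass// free_ext_semilinear.
Qed.

Lemma presented_ext (F G : presented rel -> W) :
  GRing.linear_for (th \; *:%R) F -> GRing.linear_for (th \; *:%R) G ->
  (forall k, F (gen rel k) = G (gen rel k)) -> F =1 G.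
Proof.
move=> Fl Gl FG X.
have zero (H : presented rel -> W) : GRing.linear_for (th \; *:%R) H -> H 0 = 0.
  move=> Hl; have /= := Hl 1 0 0; rewrite scaler0 addr0 rmorph1.
  by rewrite scale1r => /eqP; rewrite -subr_eq subrr => /eqP.
rewrite -(pclass_repr X) (monalgE (repr X)) linear_sum.
elim: (X in \sum_(i <- X) _) => [|k s IHs]; first by rewrite big_nil !zero.
rewrite big_cons.
have -> : << (repr X)@_k *g k >> = (repr X)@_k *: << k >> :> {malg K[T]}.
  apply/malgP => k'; rewrite mcoeffZ !mcoeffU.
  by case: (k == k'); rewrite ?mulr1n ?mulr1 ?mulr0n ?mulr0.
by rewrite linearZ /= -genE Fl Gl IHs FG.
Qed.

Lemma free_ext_rel (f : T -> W) a k1 k2 k3 :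
  free_ext th f (<< k1 >> - a *: << k2 >> - << k3 >>) =
  f k1 - th a *: f k2 - f k3.
Proof.
have -> : << k1 >> - a *: << k2 >> - << k3 >> =
    - 1 *: << k3 >> + (- a *: << k2 >> + << k1 >>) :> {malg K[T]}.
  by rewrite scaleN1r scaleNr addrC [- _ + << k1 >>]addrC.
rewrite !free_ext_semilinear /= !free_ext_gen !rmorphN rmorph1.
by rewrite scaleN1r scaleNr addrC [- _ + f k1]addrC.
Qed.

End Lift.

Section Tensor.
Variables (K : fieldType).

(* Words over V stand for elementary tensors. As the relations are            *)
(* homogeneous, this quotient of the free vector space on all words is the    *)
(* direct sum over k of the algebraic k-th tensor powers of V.                *)
Definition tensor_rel (V : lmodType K) : set {malg K[seq V]} :=
  [set r | exists u a x y w, r = << u ++ (a *: x + y) :: w >>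
    - a *: << u ++ x :: w >> - << u ++ y :: w >>].

Definition tensor (V : lmodType K) : Type := presented (@tensor_rel V).
HB.instance Definition _ V := GRing.Lmodule.on (tensor V).

Definition tens (V : lmodType K) (u : seq V) : tensor V := gen (@tensor_rel V) u.

Definition tlift (V W : lmodType K) (th : K -> K) (f : seq V -> W) :
  tensor V -> W := lift th f.

Definition multilinear (V W : lmodType K) (th : K -> K) (f : seq V -> W) :=
  forall u a x y w,
    f (u ++ (a *: x + y) :: w) = th a *: f (u ++ x :: w) + f (u ++ y :: w).

Lemma multilinear_respects (V W : lmodType K) (th : {rmorphism K -> K})
  (f : seq V -> W) : multilinear th f -> respects (@tensor_rel V) th f.
Proof.
move=> fm r [u [a [x [y [w ->]]]]].
by rewrite free_ext_rel fm addrAC addrK subrr.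
Qed.

Lemma tlift_tens (V W : lmodType K) (th : {rmorphism K -> K}) (f : seq V -> W)
  u : multilinear th f -> tlift th f (tens u) = f u.
Proof. by move/multilinear_respects; exact: lift_gen. Qed.

Lemma tlift_semilinear (V W : lmodType K) (th : {rmorphism K -> K})
    (f : seq V -> W) :
  multilinear th f -> GRing.linear_for (th \; *:%R) (tlift th f).
Proof. by move/multilinear_respects; exact: lift_semilinear. Qed.

Lemma tensor_ext (V W : lmodType K) (th : {rmorphism K -> K})
    (F G : tensor V -> W) :
  GRing.linear_for (th \; *:%R) F -> GRing.linear_for (th \; *:%R) G ->
  (forall u, F (tens u) = G (tens u)) -> F =1 G.
Proof. exact: presented_ext. Qed.

Lemma tens_multilinear (V : lmodType K) : multilinear idfun (@tens V).
Proof.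
move=> u a x y w; apply/eqP; rewrite -subr_eq0 opprD addrA.
rewrite /tens !genE -linearZ -!linearB /= -[0](linear0 (pclass (@tensor_rel V))).
by rewrite pclass_eq subr0; apply: mem_lspan; exists u, a, x, y, w.
Qed.

Definition tlift2 (V W : lmodType K) (th : K -> K) (f : seq V -> seq V -> W)
  (X Y : tensor V) : W := tlift th (fun u => tlift idfun (f u) Y) X.

Section TensorLift2.
Variables (V W : lmodType K) (th : {rmorphism K -> K}).
Variables (f : seq V -> seq V -> W).
Hypotheses (fl : forall w, multilinear th (f ^~ w))
  (fr : forall u, multilinear idfun (f u)).

Let tlift2_multilinear Y : multilinear th (fun u => tlift idfun (f u) Y).
Proof.
move=> u a x y w; pose F u := tlift idfun (f u) : tensor V -> W.
have Fl u' b Z1 Z2 : F u' (b *: Z1 + Z2) = b *: F u' Z1 + F u' Z2.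
  exact: (tlift_semilinear (th := idfun) (fr u')).
rewrite -!/(F _ _); move: Y; apply: (tensor_ext (th := idfun)) => [|b Z1 Z2|v].
- by move=> b Z1 Z2; rewrite Fl.
- rewrite !Fl /= !scalerDr !scalerA.
  by rewrite [b * _]mulrC addrACA.
- by rewrite /F !(tlift_tens (th := idfun))// fl.
Qed.

Lemma tlift2_tens u w : tlift2 th f (tens u) (tens w) = f u w.
Proof.
by rewrite /tlift2 (tlift_tens _ (tlift2_multilinear _)) (tlift_tens (th := idfun)).
Qed.

Lemma tlift2_semilinear_l Y :
  GRing.linear_for (th \; *:%R) (tlift2 th f ^~ Y).
Proof. exact: tlift_semilinear. Qed.

Lemma tlift2_linear_r X : linear (tlift2 th f X).
Proof.
move=> a Y Z; rewrite /tlift2; move: X.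
have sl := fun Y => tlift_semilinear (tlift2_multilinear Y).
apply: (tensor_ext (th := th)) => [|b X1 X2|u]; first exact: sl.
- by rewrite /= !sl /= !scalerDr !scalerA [a * _]mulrC addrACA.
- rewrite !(tlift_tens _ (tlift2_multilinear _)).
  exact: (tlift_semilinear (th := idfun) (fr u)).
Qed.

End TensorLift2.

Definition tmul (V : lmodType K) : tensor V -> tensor V -> tensor V :=
  tlift2 idfun (fun u w => tens (u ++ w)).

Let cat_multilinear_l (V : lmodType K) (w : seq V) :
  multilinear idfun (fun u => tens (u ++ w)).
Proof. by move=> u a x y v; rewrite -!catA /= tens_multilinear. Qed.

Let cat_multilinear_r (V : lmodType K) (u : seq V) :
  multilinear idfun (fun w => tens (u ++ w)).
Proof. by move=> v a x y w; rewrite !catA tens_multilinear. Qed.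

Lemma tmul_tens (V : lmodType K) (u w : seq V) :
  tmul (tens u) (tens w) = tens (u ++ w).
Proof. exact: (tlift2_tens (th := idfun)). Qed.

Lemma tmul_linear_l (V : lmodType K) (Y : tensor V) : linear (@tmul V ^~ Y).
Proof. exact: (tlift2_semilinear_l (th := idfun)). Qed.

Lemma tmul_linear_r (V : lmodType K) (X : tensor V) : linear (tmul X).
Proof. exact: (tlift2_linear_r (th := idfun)). Qed.

Definition tscalar (V : lmodType K) : tensor V -> K :=
  tlift (W := K^o) idfun (fun u => (u == [::])%:R).

Lemma tscalar_tens (V : lmodType K) (u : seq V) :
  tscalar (tens u) = (u == [::])%:R.
Proof.
rewrite /tscalar (tlift_tens (th := idfun))// => v a x y v'.
by case: v => [|? ?]; rewrite /= scaler0 addr0.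
Qed.

Section Symmetrisation.
Variable V : lmodType K.

Definition tensor_perm (u : seq V) (s : {perm 'I_(size u)}) : tensor V :=
  tens [seq u`_(s i) | i <- enum 'I_(size u)].

Definition Sym : tensor V -> tensor V := tlift idfun (fun u =>
  (size u)`!%:R^-1 *: \sum_(s : {perm 'I_(size u)}) tensor_perm s).

Let symn n (u : seq V) : tensor V := n`!%:R^-1 *:
  \sum_(s : {perm 'I_n}) tens [seq u`_(s i) | i <- enum 'I_n].

Let SymE u : (size u)`!%:R^-1 *: (\sum_(s : {perm 'I_(size u)}) tensor_perm s)
  = symn (size u) u.
Proof. by []. Qed.

Let seq_permE (u w : seq V) n (s : {perm 'I_n}) :
    n = (size u + (size w).+1)%N ->
  exists A B, forall z, [seq (u ++ z :: w)`_(s i) | i <- enum 'I_n] = A ++ z :: B.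
Proof.
move=> nE; have ku : (size u < n)%N by rewrite nE -addSnnS leq_addr.
pose i0 := (s^-1)%g (Ordinal ku).
pose e := enum 'I_n; pose f z := fun i : 'I_n => (u ++ z :: w)`_(s i).
have i0e : i0 \in e by rewrite mem_enum.
have eE : e = take (index i0 e) e ++ i0 :: drop (index i0 e).+1 e.
  rewrite -[LHS](cat_take_drop (index i0 e)); congr (_ ++ _).
  by rewrite (drop_nth i0) ?index_mem// nth_index.
have ue : uniq e by exact: enum_uniq.
have fz z i : i != i0 -> f z i = f 0 i.
  move=> ii0; rewrite /f !nth_cat; case: ltnP => // le_us.
  suff lt_us : (size u < s i)%N by rewrite -(subnSK lt_us).
  rewrite ltn_neqAle le_us andbT; apply: contra_neq ii0 => us.
  by apply: (canRL (permK s)); apply: val_inj.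
exists [seq f 0 i | i <- take (index i0 e) e],
  [seq f 0 i | i <- drop (index i0 e).+1 e] => z.
transitivity (map (f z) e); first by [].
rewrite {1}eE map_cat map_cons.
have -> : f z i0 = z by rewrite /f permKV /= nth_cat ltnn subnn.
rewrite eE cat_uniq /= in ue; case/and4P: ue => _; rewrite negb_or => /andP[i1 _] i2 _.
congr (_ ++ _ :: _); apply/eq_in_map => i ie; apply: fz;
  by apply: contraTneq ie => ->.
Qed.

Lemma Sym_multilinear : multilinear idfun (fun u : seq V =>
  (size u)`!%:R^-1 *: \sum_(s : {perm 'I_(size u)}) tensor_perm s).
Proof.
move=> u a x y w; rewrite !SymE !size_cat /=.
rewrite /symn scalerA mulrC -scalerA -scalerDr; congr (_ *: _).
rewrite scaler_sumr -big_split /=; apply: eq_bigr => s _.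
have [A [B E]] := seq_permE s (erefl (size u + (size w).+1)%N).
by rewrite !E tens_multilinear.
Qed.

Lemma Sym_tens u : Sym (tens u) =
  (size u)`!%:R^-1 *: \sum_(s : {perm 'I_(size u)}) tensor_perm s.
Proof. exact: (tlift_tens (th := idfun) _ Sym_multilinear). Qed.

Lemma Sym_tens_size n u : size u = n -> Sym (tens u) =
  n`!%:R^-1 *: \sum_(s : {perm 'I_n}) tens [seq u`_(s i) | i <- enum 'I_n].
Proof. by move=> <-; exact: Sym_tens. Qed.

Lemma Sym_is_linear : linear Sym.
Proof. exact: (tlift_semilinear (th := idfun) Sym_multilinear). Qed.

HB.instance Definition _ :=
  GRing.isLinear.Build K (tensor V) (tensor V) *:%R Sym Sym_is_linear.

Definition symmetric_tensor : {pred tensor V} :=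
  fun X => `[< exists Y, X = Sym Y >].

Lemma symmetric_tensor_submod_closed : submod_closed symmetric_tensor.
Proof.
split; first by apply/asboolP; exists 0; rewrite linear0.
move=> a _ _ /asboolP[X ->] /asboolP[Y ->].
by apply/asboolP; exists (a *: X + Y); rewrite linearP.
Qed.

HB.instance Definition _ := GRing.isSubmodClosed.Build K (tensor V)
  symmetric_tensor symmetric_tensor_submod_closed.

Lemma Sym_symmetric X : Sym X \in symmetric_tensor.
Proof. by apply/asboolP; exists X. Qed.

Record symtensor : Type := SymTensor {
  symtensor_val :> tensor V;
  symtensorP : symtensor_val \in symmetric_tensor }.

HB.instance Definition _ := [isSub for symtensor_val].
HB.instance Definition _ := [Choice of symtensor by <:].
HB.instance Definition _ := [SubChoice_isSubLmodule of symtensor by <:].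

Definition symmetrise (X : tensor V) : symtensor := SymTensor (Sym_symmetric X).

End Symmetrisation.

Section OuterTensor.
Variables E F : lmodType K.

Definition otensor_rel : set {malg K[(E * F)%type]} :=
  [set r | (exists a x y z,
      r = << (a *: x + y, z) >> - a *: << (x, z) >> - << (y, z) >>)
    \/ (exists a x y z,
      r = << (z, a *: x + y) >> - a *: << (z, x) >> - << (z, y) >>)].

Definition otensor : Type := presented otensor_rel.
HB.instance Definition _ := GRing.Lmodule.on otensor.

Definition otens (x : E) (y : F) : otensor := gen otensor_rel (x, y).

Lemma otens_linear_l y : linear (otens^~ y).
Proof.
move=> a x x'; apply/eqP; rewrite -subr_eq0 opprD addrA.
rewrite /otens !genE -linearZ -!linearB /= -[0](linear0 (pclass otensor_rel)).
by rewrite pclass_eq subr0; apply: mem_lspan; left; exists a, x, x', y.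
Qed.

Lemma otens_linear_r x : linear (otens x).
Proof.
move=> a y y'; apply/eqP; rewrite -subr_eq0 opprD addrA.
rewrite /otens !genE -linearZ -!linearB /= -[0](linear0 (pclass otensor_rel)).
by rewrite pclass_eq subr0; apply: mem_lspan; right; exists a, y, y', x.
Qed.

Definition olift (W : lmodType K) (f : E -> F -> W) : otensor -> W :=
  lift idfun (fun z => f z.1 z.2).

Lemma olift_respects (W : lmodType K) (f : E -> F -> W) :
    (forall y, linear (f^~ y)) -> (forall x, linear (f x)) ->
  respects otensor_rel idfun (fun z => f z.1 z.2).
Proof.
move=> fl fr r [] [a [x [y [z ->]]]]; rewrite (free_ext_rel idfun) /=.
  by rewrite fl addrAC addrK subrr.
by rewrite fr addrAC addrK subrr.
Qed.

Lemma olift_otens (W : lmodType K) (f : E -> F -> W) x y :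
    (forall y, linear (f^~ y)) -> (forall x, linear (f x)) ->
  olift f (otens x y) = f x y.
Proof.
by move=> fl fr; rewrite /olift (lift_gen (th := idfun))//; exact: olift_respects.
Qed.

Lemma olift_linear (W : lmodType K) (f : E -> F -> W) :
    (forall y, linear (f^~ y)) -> (forall x, linear (f x)) ->
  linear (olift f).
Proof.
move=> fl fr; apply: (lift_semilinear (th := idfun)).
exact: olift_respects.
Qed.

End OuterTensor.

Section StarProduct.
Variable V : lmodType K.

(* With u = x_1 ... x_k, the head of rev u is x_k and u' lists the entries    *)
(* x_(k-1), ..., x_1.                                                         *)
Definition contract (Lam : V -> V -> K) (u w : seq V) :
    otensor (tensor V) (tensor V) :=
  match rev u, w with
  | x :: u', y :: w' =>
    ((size u * size w)%:R * Lam x y) *: otens (tens (rev u')) (tens w')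
  | _, _ => 0
  end.

Definition P_op (Lam : V -> V -> K) :
    otensor (tensor V) (tensor V) -> otensor (tensor V) (tensor V) :=
  olift (tlift2 idfun (contract Lam)).

Definition mu_vee (Z : otensor (tensor V) (tensor V)) : symtensor V :=
  symmetrise (olift (@tmul V) Z).

(* All but finitely many terms vanish, since P_op lowers the degrees.         *)
Definition star (Lam : V -> V -> K) (X Y : symtensor V) : symtensor V :=
  \sum_(t \in [set: nat])
    t`!%:R^-1 *: mu_vee (iter t (P_op Lam) (otens (X : tensor V) (Y : tensor V))).

Lemma contract0l Lam w : contract Lam [::] w = 0.
Proof. by []. Qed.

Lemma contract0r Lam u : contract Lam u [::] = 0.
Proof. by rewrite /contract; case: (rev u). Qed.

Lemma contract_rcons_cons Lam u x y w : contract Lam (rcons u x) (y :: w) =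
  (((size u).+1 * (size w).+1)%:R * Lam x y) *: otens (tens u) (tens w).
Proof. by rewrite /contract rev_rcons revK size_rcons. Qed.

Let scale_form (W : lmodType K) (a c l l' : K) (Z : W) :
  (c * (a * l + l')) *: Z = a *: ((c * l) *: Z) + (c * l') *: Z.
Proof. by rewrite mulrDr scalerDl scalerA mulrCA. Qed.

Let scale_comm (W : lmodType K) (a c : K) (Z Z' : W) :
  c *: (a *: Z + Z') = a *: (c *: Z) + c *: Z'.
Proof. by rewrite scalerDr !scalerA mulrC. Qed.

Section BilinearForm.
Variable Lam : V -> V -> K.
Hypothesis Lam_bilin : bilinear_for *%R *%R Lam.

Let contract_multilinear_l w : multilinear idfun (contract Lam ^~ w).
Proof.
case: w => [|y w] u a x x' v /=; first by rewrite !contract0r scaler0 addr0.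
case: (lastP v) => [|{}v z].
  rewrite !cats1 !contract_rcons_cons (Lam_bilin.1 y a x x').
  exact: scale_form.
rewrite -!rcons_cons -!rcons_cat !contract_rcons_cons !size_cat /=.
by rewrite tens_multilinear otens_linear_l scale_comm.
Qed.

Let contract_multilinear_r u : multilinear idfun (contract Lam u).
Proof.
case: (lastP u) => [|{}u z] v a y y' w /=; first by rewrite scaler0 addr0.
case: v => [|y0 v] /=; rewrite !contract_rcons_cons.
  rewrite (Lam_bilin.2 z a y y').
  exact: scale_form.
by rewrite !size_cat /= tens_multilinear otens_linear_r scale_comm.
Qed.

Lemma P_op_otens u w :
  P_op Lam (otens (tens u) (tens w)) = contract Lam u w.
Proof.
rewrite /P_op olift_otens ?(tlift2_tens (th := idfun))//.
  exact: (tlift2_semilinear_l (th := idfun)).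
exact: (tlift2_linear_r (th := idfun)).
Qed.

Lemma P_op_linear : linear (P_op Lam).
Proof.
apply: olift_linear.
  exact: (tlift2_semilinear_l (th := idfun)).
exact: (tlift2_linear_r (th := idfun)).
Qed.

End BilinearForm.

Lemma mu_vee_otens u w :
  mu_vee (otens (tens u) (tens w)) = symmetrise (tens (u ++ w)).
Proof.
by rewrite /mu_vee olift_otens ?tmul_tens//; [exact: tmul_linear_l|exact: tmul_linear_r].
Qed.

End StarProduct.
End Tensor.

Section ComplexTensor.
Variables (R : realType) (V : lmodType R[i]).
Local Notation C := R[i].

Definition hnorm (h : V -> V -> C) (v : V) : C := sqrtC (h v v).

Definition positive_hermitian (h : V -> V -> C) : Prop :=
  [/\ bilinear_for (conjC \; *%R) *%R h,
      forall v w, h v w = (h w v)^*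
    & forall v, 0 <= h v v].

(* Elementary tensors of different degrees are orthogonal.                    *)
Definition word_form (h : V -> V -> C) (u w : seq V) : C :=
  if size u == size w then (size u)`!%:R * \prod_(p <- zip u w) h p.1 p.2
  else 0.

Definition tform (h : V -> V -> C) : tensor V -> tensor V -> C :=
  tlift2 (W := C^o) conjC (word_form h).

Definition tnorm (h : V -> V -> C) (X : tensor V) : C := sqrtC (tform h X X).

Section Form.
Variable h : V -> V -> C.
Hypothesis h_sesq : bilinear_for (conjC \; *%R) *%R h.

Let split_size (T : Type) (u : seq T) m n : size u = (m + n.+1)%N ->
  exists u1 z u2, [/\ u = u1 ++ z :: u2, size u1 = m & size u2 = n].
Proof.
move=> su; case: u su => [|z0 u0]; first by rewrite addnS.
move=> su; set u := z0 :: u0 in su *.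
have mu : (m < size u)%N by rewrite su -addSnnS leq_addr.
exists (take m u), (nth z0 u m), (drop m.+1 u).
rewrite size_takel 1?ltnW// size_drop su -addSnnS addKn; split=> //.
by rewrite -drop_nth// cat_take_drop.
Qed.

Let word_formE u1 z1 v1 u2 z2 v2 :
    size u1 = size u2 -> size v1 = size v2 ->
  word_form h (u1 ++ z1 :: v1) (u2 ++ z2 :: v2) =
  (size u1 + (size v1).+1)`!%:R * (\prod_(p <- zip u1 u2) h p.1 p.2 *
    (h z1 z2 * \prod_(p <- zip v1 v2) h p.1 p.2)).
Proof.
move=> su sv; rewrite /word_form !size_cat /= su sv eqxx.
by rewrite zip_cat// big_cat /= big_cons.
Qed.

Let word_form_multilinear_l w :
  multilinear (W := C^o) conjC (word_form h ^~ w).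
Proof.
move=> u a x y v /=; have [sw|sw] := eqVneq (size w) (size u + (size v).+1)%N.
  have [w1 [z [w2 [-> sw1 sw2]]]] := split_size sw.
  rewrite !word_formE// (h_sesq.1 z a x y) /=.
  by rewrite /GRing.scale /=; ring.
by rewrite /word_form !size_cat /= ![_ == size w]eq_sym !(negbTE sw) scaler0 addr0.
Qed.

Let word_form_multilinear_r u : multilinear (W := C^o) idfun (word_form h u).
Proof.
move=> v a x y w /=; have [su|su] := eqVneq (size u) (size v + (size w).+1)%N.
  have [u1 [z [u2 [-> su1 su2]]]] := split_size su.
  rewrite !word_formE// (h_sesq.2 z a x y) /=.
  by rewrite /GRing.scale /=; ring.
by rewrite /word_form !size_cat /= !(negbTE su) scaler0 addr0.
Qed.

Lemma tform_tens u w : tform h (tens u) (tens w) = word_form h u w.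
Proof. exact: (tlift2_tens (W := C^o) (th := conjC)). Qed.

Lemma tform_sesquilinear : bilinear_for (conjC \; *%R) *%R (tform h).
Proof.
split.
  exact: (tlift2_semilinear_l (W := C^o) (th := conjC)).
exact: (tlift2_linear_r (W := C^o) (th := conjC)).
Qed.

End Form.

Section Involution.
Variable bar : {linear V -> V | conjC \; *:%R}.

Definition tstar : tensor V -> tensor V :=
  tlift conjC (fun u => tens (rev (map bar u))).

Let tstar_multilinear : multilinear conjC (fun u => tens (rev (map bar u))).
Proof.
move=> u a x y w; rewrite !map_cat /= !rev_cat !rev_cons !cat_rcons.
by rewrite linearP tens_multilinear.
Qed.

Lemma tstar_tens u : tstar (tens u) = tens (rev (map bar u)).
Proof. exact: (tlift_tens (th := conjC)). Qed.

Lemma tstar_semilinear : GRing.linear_for (conjC \; *:%R) tstar.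
Proof. exact: (tlift_semilinear (th := conjC)). Qed.

Lemma tstarD X Y : tstar (X + Y) = tstar X + tstar Y.
Proof. by rewrite -[X]scale1r tstar_semilinear /= rmorph1 !scale1r. Qed.

Lemma tstar0 : tstar 0 = 0.
Proof. by have /eqP := tstarD 0 0; rewrite addr0 -subr_eq subrr => /eqP. Qed.

Lemma tstarZ a X : tstar (a *: X) = a^* *: tstar X.
Proof. by rewrite -[a *: X]addr0 tstar_semilinear tstar0 addr0. Qed.

Lemma tstar_sum (I : Type) (r : seq I) (P : pred I) (F : I -> tensor V) :
  tstar (\sum_(i <- r | P i) F i) = \sum_(i <- r | P i) tstar (F i).
Proof. exact: (big_morph _ tstarD tstar0). Qed.

Let rev_enum_ord n : rev (enum 'I_n) = map (@rev_ord n) (enum 'I_n).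
Proof.
apply: (inj_map val_inj); rewrite map_rev val_enum_ord -map_comp.
apply: (@eq_from_nth _ 0%N) => [|i]; rewrite size_rev size_iota.
  by rewrite size_map -cardE card_ord.
move=> ltin; rewrite nth_rev ?size_iota// nth_iota ?rev_ord_proof//.
  rewrite (nth_map (Ordinal ltin)) ?size_enum_ord//= nth_enum_ord//.
by rewrite ltn_subrL (leq_ltn_trans _ ltin).
Qed.

Lemma tstar_Sym X : tstar (Sym X) = Sym (tstar X).
Proof.
move: X; apply: (tensor_ext (th := conjC)) => [a X Y|a X Y|u].
- by rewrite linearP tstar_semilinear.
- by rewrite tstar_semilinear /= linearP.
pose n := size u; pose r : {perm 'I_n} := perm (@rev_ord_inj n).
rewrite tstar_tens (@Sym_tens_size _ _ n u)//.
rewrite (@Sym_tens_size _ _ n (rev (map bar u))); last by rewrite size_rev size_map.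
rewrite tstarZ fmorphV /= conjC_nat tstar_sum; congr (_ *: _).
rewrite [RHS](reindex_inj (mulgI r)) [RHS](reindex_inj (mulIg r)) /=.
apply: eq_bigr => s _; rewrite tstar_tens; congr tens.
rewrite -map_comp -map_rev rev_enum_ord -map_comp; apply: eq_map => i /=.
rewrite !permM !permE nth_rev size_map ?rev_ord_proof//=.
by rewrite subnSK ?ltn_ord// (subKn (ltnW _)) ?(nth_map 0)//; exact: ltn_ord.
Qed.

Lemma tstar_symmetric (X : tensor V) :
  X \in @symmetric_tensor _ V -> tstar X \in @symmetric_tensor _ V.
Proof.
by move=> /asboolP[Y ->]; rewrite tstar_Sym Sym_symmetric.
Qed.

Definition sstar (X : symtensor V) : symtensor V :=
  SymTensor (tstar_symmetric (symtensorP X)).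

End Involution.
End ComplexTensor.

Section Topology.
Variables (R : realType).
Local Notation C := R[i].

(* The axioms of tvsType, for an arbitrary topology t on the vector space E.  *)
Definition locally_convex_topology (E : lmodType C) (t : Topological E) : Prop :=
  let Et : topologicalType := Topological.Pack t in
  [/\ continuous (fun z : Et * Et => (z.1 : E) + (z.2 : E) : Et),
      continuous (fun z : C^o * Et => (z.1 : C) *: (z.2 : E) : Et)
    & exists2 B : set_system Et,
        (forall b, b \in B -> convex_set (b : set E)) & basis B].

Definition seminorm (E : lmodType C) (p : E -> C) : Prop :=
  [/\ forall v, 0 <= p v,
      forall a v, p (a *: v) = `|a| * p v
    & forall v w, p (v + w) <= p v + p w].

Variable V : tvsType C.

Definition continuous_form (f : V -> V -> C) : Prop :=
  continuous (fun z : V * V => f z.1 z.2 : C^o).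

Definition continuous_hilbert_form : set (V -> V -> C) :=
  [set h | positive_hermitian h /\ continuous_form h].

Definition hilbert_cofinal : Prop :=
  forall p : V -> C, seminorm p -> continuous (p : V -> C^o) ->
    exists2 h, continuous_hilbert_form h & forall v, p v <= hnorm h v.

(* tnorm h (Y - X) is a non-negative complex number, so the comparison with e *)
(* is the one of the underlying reals.                                        *)
Definition tensor_subbase : set (set (tensor V)) :=
  [set B | exists h X e, [/\ continuous_hilbert_form h, 0 < e &
    B = [set Y | tnorm h (Y - X) < e]]].

HB.instance Definition _ :=
  isSubBaseTopological.Build (tensor V) tensor_subbase id.

HB.instance Definition _ := Topological.copy (symtensor V)
  (initial_topology (@symtensor_val _ V : symtensor V -> tensor V)).

Definition symtensor_topology : Topological (symtensor V) :=
  Topological.on (symtensor V).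

Section Conjugation.
Variable bar : {linear V -> V | conjC \; *:%R}.

Definition hermitian_bilinear (Lam : V -> V -> C) : Prop :=
  bilinear_for *%R *%R Lam /\ forall v w, Lam v w = (Lam (bar w) (bar v))^*.

Definition Lambda_of (h : V -> V -> C) (v w : V) : C := h (bar v) w.

Definition operations_continuous (t : Topological (symtensor V)) : Prop :=
  let St : topologicalType := Topological.Pack t in
  [/\ forall Lam, continuous_form Lam -> hermitian_bilinear Lam ->
        continuous (fun z : St * St => star Lam z.1 z.2 : St),
      continuous (sstar bar : St -> St)
    & continuous (fun X : St => tscalar (X : symtensor V) : C^o)].

End Conjugation.
End Topology.

(* Main.v *)
Require Import Defs.
From mathcomp Require Import all_boot all_order all_algebra perm.
From mathcomp Require Import complex finmap monalg ring zify.
From mathcomp Require Import all_classical all_reals topology normedtype convex interval_inference.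

Set Implicit Arguments.
Unset Strict Implicit.
Unset Printing Implicit Defensive.

Import Order.TTheory GRing.Theory Num.Theory Num.Def.
Import numFieldNormedType.Exports.

Local Open Scope classical_set_scope.
Local Open Scope ring_scope.

(** The topology on symmetric tensors is controlled by one estimate and one
identity.

The estimate is the continuity of the star products. Let h be a positive
Hermitian form with |Lam(v, w)|^2 <= h(v, v) h(w, w). Then
||X * Y||_h <= 4 ||X||_(8h) ||Y||_(8h) for the norms on the tensor algebra
(star_le). An element of the outer tensor product is measured by its
decompositions into a sum of F_i (x) G_i, through the sum of ||F_i||^2 and the
sum of ||G_i||^2 (otensor_bounded). The contraction P_Lam respects such bounds:
if (e_j) is an h-orthonormal family spanning, up to h-null vectors, the last
letters of the left factor, then Lam(x, y) is the sum of h(e_j, x) Lam(e_j, y).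
Contracting the left factor by the functionals h(e_j, -) preserves the total
square norm by the Parseval identity (qsum_contract_orthonormal), contracting
the right factor by Lam(e_j, -) does not increase it by the Bessel inequality
(qsum_contract_bessel); only the weight attached to each degree changes, by the
factor k^2 and a shift. For t contractions the resulting weight in degree k is at most
(2 t! / 4^t) 8^k k! (iter_prod_weight_le): the t! is compensated by the 1 / t!
in the star product, 8^k by the passage from h to 8h, and the sum over t
converges.
Multiplication in the tensor algebra is bounded at the price of a geometric
weight (tensor_form_tmul_le), and symmetrisation is an orthogonal projection,
hence a contraction (fnorm_Sym). The square norms of formal sums of words are
values of positive semidefinite kernels, and the inequalities between them rest on
Schur's product theorem (psd_schur).

Every continuous bilinear form satisfies the hypothesis of the estimate for some
continuous h: two successive polar seminorms bound it by a product of continuous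
seminorms (continuous_bilinear_bounded), and these are bounded by Hilbert
seminorms. So all star products are continuous; the involution exchanges the
norm of h with that of the conjugate form, and the scalar part is the inner
product with the unit.

The identity says that the scalar part of X^* * Y is the inner product of X and
Y (tscalar_star_tensor_star): in the scalar part only the complete contractions
survive, and for words of length t their coefficient is t!^2 / t! = t!, the
normalisation of the inner product. Conversely, then, any locally convex
topology for which the operations are continuous makes X |-> ||X||_h^2
continuous, hence all balls of the Hilbert norms are neighbourhoods
(symtensor_topology_coarsest). *)

Local Notation Sym := Defs.Sym.
Local Notation contract := Defs.contract.
Local Notation olift := Defs.olift.

(** * Positive Hermitian forms *)

(** The estimates need no completeness of the scalars, so they are carried out over
an arbitrary numClosedFieldType; for R[i] this predicate unfolds to
positive_hermitian. *)
Definition hermitian_form (K : numClosedFieldType) (E : lmodType K)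
    (f : E -> E -> K) : Prop :=
  [/\ bilinear_for (conjC \; *%R) *%R f,
      forall x y, f x y = (f y x)^*
    & forall x, 0 <= f x x].

Definition fnorm (K : numClosedFieldType) (E : lmodType K) (f : E -> E -> K)
  (x : E) : K := sqrtC (f x x).

Section HermitianForms.
Variables (K : numClosedFieldType) (E : lmodType K) (f : E -> E -> K).
Hypothesis f_pos : hermitian_form f.

Lemma form_sesq : bilinear_for (conjC \; *%R) *%R f.
Proof. by case: f_pos. Qed.

Lemma form_conj x y : f x y = (f y x)^*.
Proof. by case: f_pos. Qed.

Lemma form_ge0 x : 0 <= f x x.
Proof. by case: f_pos. Qed.

Lemma formDl x x' y : f (x + x') y = f x y + f x' y.
Proof. by have := form_sesq.1 y 1 x x'; rewrite /= rmorph1 mul1r scale1r. Qed.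

Lemma formDr x y y' : f x (y + y') = f x y + f x y'.
Proof. by have := form_sesq.2 x 1 y y'; rewrite /= mul1r scale1r. Qed.

Lemma form0l y : f 0 y = 0.
Proof. by apply: (addrI (f 0 y)); rewrite -formDl !addr0. Qed.

Lemma form0r x : f x 0 = 0.
Proof. by apply: (addrI (f x 0)); rewrite -formDr !addr0. Qed.

Lemma formZl a x y : f (a *: x) y = a^* * f x y.
Proof. by have := form_sesq.1 y a x 0; rewrite /= addr0 form0l addr0. Qed.

Lemma formZr a x y : f x (a *: y) = a * f x y.
Proof. by have := form_sesq.2 x a y 0; rewrite /= addr0 form0r addr0. Qed.

Lemma formNl x y : f (- x) y = - f x y.
Proof. by rewrite -scaleN1r formZl rmorphN1 mulN1r. Qed.

Lemma formNr x y : f x (- y) = - f x y.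
Proof. by rewrite -scaleN1r formZr mulN1r. Qed.

Lemma form_suml I (r : seq I) (P : pred I) (F : I -> E) y :
  f (\sum_(i <- r | P i) F i) y = \sum_(i <- r | P i) f (F i) y.
Proof. exact: (big_morph (f^~ y) (fun a b => formDl a b y) (form0l y)). Qed.

Lemma form_sumr I (r : seq I) (P : pred I) (F : I -> E) x :
  f x (\sum_(i <- r | P i) F i) = \sum_(i <- r | P i) f x (F i).
Proof. exact: (big_morph _ (formDr x) (form0r x)). Qed.

Lemma form_norm2 x y : `|f x y| ^+ 2 = f x y * f y x.
Proof. by rewrite normCK -form_conj. Qed.

Lemma form_combination a b x y :
  f (a *: x + b *: y) (a *: x + b *: y) =
  a^* * a * f x x + a^* * b * f x y + b^* * a * f y x + b^* * b * f y y.
Proof. by rewrite !formDl !formDr !formZl !formZr; ring. Qed.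

Lemma cauchy_schwarz x y : `|f x y| ^+ 2 <= f x x * f y y.
Proof.
rewrite form_norm2; have fc := form_conj.
have real_form z : (f z z)^* = f z z by rewrite -form_conj.
(* The classical argument, with the test vector f(u,u) v - f(u,v) u. *)
have key u v : f u u != 0 -> f u v * f v u <= f u u * f v v.
  move=> fu0; have fu : 0 < f u u by rewrite lt_def fu0 form_ge0.
  rewrite -subr_ge0 -(pmulr_rge0 _ fu).
  have := form_ge0 (f u u *: v + (- f u v) *: u).
  rewrite form_combination real_form rmorphN /= -form_conj.
  by congr (0 <= _); ring.
have [x0|] := eqVneq (f x x) 0; last exact: key.
have [y0|] := eqVneq (f y y) 0; last by move/key; rewrite mulrC [f x x * _]mulrC.
(* If both vectors are null, the value at y - f(x,y) x is -2 |f(x,y)|^2. *)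
have := form_ge0 (1 *: y + (- f x y) *: x).
rewrite form_combination x0 y0 rmorphN rmorph1 /= -form_conj => H.
rewrite mul0r -(@pmulr_rle0 _ 2) ?ltr0n// -oppr_ge0.
by move: H; congr (0 <= _); ring.
Qed.

Lemma null_orthogonal x y : f x x = 0 -> f x y = 0.
Proof.
move=> x0; have := cauchy_schwarz x y; rewrite x0 mul0r.
by rewrite -normrX normr_le0 expf_eq0 => /eqP.
Qed.

Lemma fnorm_ge0 x : 0 <= fnorm f x.
Proof. by rewrite sqrtC_ge0 form_ge0. Qed.

Lemma fnorm_sqr x : fnorm f x ^+ 2 = f x x.
Proof. exact: sqrtCK. Qed.

Lemma cauchy_schwarz_fnorm x y : `|f x y| <= fnorm f x * fnorm f y.
Proof.
rewrite -(@ler_pXn2r _ 2) ?nnegrE ?mulr_ge0 ?fnorm_ge0//.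
by rewrite exprMn !fnorm_sqr cauchy_schwarz.
Qed.

Lemma fnormZ a x : fnorm f (a *: x) = `|a| * fnorm f x.
Proof.
apply/eqP; rewrite -(@eqrXn2 _ 2) ?mulr_ge0 ?fnorm_ge0//.
by rewrite exprMn !fnorm_sqr formZl formZr normCK mulrA [a^* * a]mulrC.
Qed.

Lemma fnorm0 : fnorm f 0 = 0.
Proof. by rewrite /fnorm form0l sqrtC0. Qed.

Lemma fnormD x y : fnorm f (x + y) <= fnorm f x + fnorm f y.
Proof.
rewrite -(@ler_pXn2r _ 2) ?nnegrE ?addr_ge0 ?fnorm_ge0//.
rewrite sqrrD !fnorm_sqr formDl !formDr -!addrA lerD2l !addrA lerD2r.
have -> : f x y + f y x = 2 * 'Re (f x y).
  by rewrite ReE mulrC divfK ?pnatr_eq0// -form_conj.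
rewrite -mulr2n -[_ * _ *+ 2]mulr_natl ler_pM2l ?ltr0n//.
apply: le_trans (cauchy_schwarz_fnorm x y).
apply: le_trans (real_ler_norm (Creal_Re _)) _.
rewrite -(@ler_pXn2r _ 2) ?nnegrE// real_normK ?Creal_Re// normC2_Re_Im.
by rewrite lerDl -realEsqr Creal_Im.
Qed.

Lemma fnorm_sum I (r : seq I) (P : pred I) (F : I -> E) :
  fnorm f (\sum_(i <- r | P i) F i) <= \sum_(i <- r | P i) fnorm f (F i).
Proof.
elim/big_rec2: _ => [|i y x _ H]; first by rewrite fnorm0.
by apply: le_trans (fnormD _ _) _; rewrite lerD2l.
Qed.

Lemma parallelogram_le x y : f (x + y) (x + y) <= 2 * f x x + 2 * f y y.
Proof.
rewrite -subr_ge0; have := form_ge0 (1 *: x + (- 1) *: y).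
rewrite scale1r scaleN1r !formDl !formDr !formNl !formNr.
by congr (0 <= _); ring.
Qed.

(** The parallelogram inequality, applied repeatedly, puts geometric weights on the
summands, so that sums over all degrees cost no constant depending on n. *)
Lemma form_sum_geometric n (x : 'I_n -> E) :
  f (\sum_(k < n) x k) (\sum_(k < n) x k) <= \sum_(k < n) 2 ^+ k.+1 * f (x k) (x k).
Proof.
elim: n x => [|n IHn] x; first by rewrite !big_ord0 form0l.
rewrite !big_ord_recl /= expr1; apply: le_trans (parallelogram_le _ _) _.
rewrite lerD2l; apply: le_trans (ler_wpM2l _ (IHn _)) _; first exact: ler0n.
by rewrite mulr_sumr ler_sum// => i _; rewrite mulrA -exprS.
Qed.

End HermitianForms.

(** * Positive semidefinite kernels *)

(** Kernels live on arbitrary types, where membership in a formal sum is List.In; it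
becomes boolean after mapping to V. *)
Lemma mem_map_In (A : Type) (B : eqType) (g : A -> B) (s : seq A) x :
  List.In x s -> g x \in [seq g y | y <- s].
Proof.
elim: s => //= y s IHs [->|/IHs]; rewrite inE ?eqxx//.
by move->; rewrite orbT.
Qed.

Section PositiveKernels.
Variables (C : numClosedFieldType) (T : Type).
Implicit Types (K : T -> T -> C) (F : seq (C * T)).

(** The quadratic form of the kernel K at the formal sum F of the c . u with
(c, u) in F. *)
Definition qsum K F : C :=
  \sum_(p <- F) \sum_(q <- F) p.1^* * q.1 * K p.2 q.2.

Definition psd K : Prop := forall F, 0 <= qsum K F.

Lemma eq_in_qsum K K' F :
    (forall p q, List.In p F -> List.In q F -> K p.2 q.2 = K' p.2 q.2) ->
  qsum K F = qsum K' F.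
Proof.
move=> KK'; rewrite /qsum.
have step (r : seq (C * T)) (G H : C * T -> C) :
    (forall p, List.In p r -> G p = H p) ->
    \sum_(p <- r) G p = \sum_(p <- r) H p.
  elim: r => [|p r IHr] GH; first by rewrite !big_nil.
  by rewrite !big_cons GH ?IHr//; [move=> q qr; apply: GH; right|left].
by apply: (step) => p pF; apply: (step) => q qF; rewrite KK'.
Qed.

Lemma eq_qsum K K' F : K =2 K' -> qsum K F = qsum K' F.
Proof. by move=> KK'; apply: eq_in_qsum => p q _ _; exact: KK'. Qed.

Lemma eq_psd K K' : K =2 K' -> psd K -> psd K'.
Proof. by move=> KK' Kp F; rewrite -(eq_qsum _ KK'). Qed.

Lemma qsumD K K' F : qsum (fun u v => K u v + K' u v) F = qsum K F + qsum K' F.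
Proof.
rewrite /qsum -big_split; apply: eq_bigr => p _ /=.
by rewrite -big_split; apply: eq_bigr => q _ /=; rewrite mulrDr.
Qed.

Lemma qsumZ a K F : qsum (fun u v => a * K u v) F = a * qsum K F.
Proof.
rewrite /qsum mulr_sumr; apply: eq_bigr => p _.
by rewrite mulr_sumr; apply: eq_bigr => q _; rewrite mulrCA.
Qed.

Lemma qsumB K K' F : qsum (fun u v => K u v - K' u v) F = qsum K F - qsum K' F.
Proof.
rewrite -[X in _ = _ + X]mulN1r -qsumZ -qsumD.
by apply: eq_qsum => u v; rewrite mulN1r.
Qed.

Lemma qsum_sum I (r : seq I) (P : pred I) (K : I -> T -> T -> C) F :
  qsum (fun u v => \sum_(i <- r | P i) K i u v) F =
  \sum_(i <- r | P i) qsum (K i) F.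
Proof.
elim: r => [|i r IHr].
  rewrite big_nil; transitivity (0 * qsum (fun _ _ => 0) F); last exact: mul0r.
  by rewrite -qsumZ; apply: eq_qsum => u v; rewrite big_nil mul0r.
rewrite big_cons -IHr; case: ifP => Pi.
  by rewrite -qsumD; apply: eq_qsum => u v; rewrite big_cons Pi.
by apply: eq_qsum => u v; rewrite big_cons Pi.
Qed.

Lemma psdD K K' : psd K -> psd K' -> psd (fun u v => K u v + K' u v).
Proof. by move=> Kp K'p F; rewrite qsumD addr_ge0. Qed.

Lemma psdZ a K : 0 <= a -> psd K -> psd (fun u v => a * K u v).
Proof. by move=> a0 Kp F; rewrite qsumZ mulr_ge0. Qed.

Lemma psd_sum I (r : seq I) (P : pred I) (K : I -> T -> T -> C) :
  (forall i, psd (K i)) -> psd (fun u v => \sum_(i <- r | P i) K i u v).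
Proof. by move=> Kp F; rewrite qsum_sum sumr_ge0// => i _; exact: Kp. Qed.

Lemma qsum_rescale (a : T -> C) K F :
  qsum (fun u v => (a u)^* * a v * K u v) F =
  qsum K [seq (p.1 * a p.2, p.2) | p <- F].
Proof.
rewrite /qsum big_map; apply: eq_bigr => p _.
by rewrite big_map; apply: eq_bigr => q _ /=; rewrite rmorphM /=; ring.
Qed.

Lemma psd_rescale (a : T -> C) K :
  psd K -> psd (fun u v => (a u)^* * a v * K u v).
Proof. by move=> Kp F; rewrite qsum_rescale. Qed.

(** The quadratic form is the squared modulus of the sum of the coefficients. *)
Lemma psd1 : psd (fun _ _ => 1).
Proof.
move=> F; rewrite [qsum _ _](_ : _ = `|\sum_(p <- F) p.1| ^+ 2) ?exprn_ge0//.
rewrite normCKC rmorph_sum /qsum mulr_suml; apply: eq_bigr => p _ /=.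
by rewrite mulr_sumr; apply: eq_bigr => q _; rewrite mulr1.
Qed.

End PositiveKernels.

Lemma qsum_comp (C : numClosedFieldType) (S T : Type) (g : S -> T) (K : T -> T -> C) F :
  qsum (fun u v => K (g u) (g v)) F = qsum K [seq (p.1, g p.2) | p <- F].
Proof.
by rewrite /qsum big_map; apply: eq_bigr => p _; rewrite big_map.
Qed.

Lemma psd_comp (C : numClosedFieldType) (S T : Type) (g : S -> T) (K : T -> T -> C) :
  psd K -> psd (fun u v => K (g u) (g v)).
Proof. by move=> Kp F; rewrite qsum_comp. Qed.

(** * Orthonormal families for a semi-definite form *)

Section GramSchmidt.
Variables (C : numClosedFieldType) (V : lmodType C) (h : V -> V -> C).
Hypothesis h_pos : hermitian_form h.

Lemma qsum_form F : qsum h F =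
  h (\sum_(p <- F) p.1 *: p.2) (\sum_(p <- F) p.1 *: p.2).
Proof.
rewrite (form_suml h_pos); apply: eq_bigr => p _.
rewrite (form_sumr h_pos); apply: eq_bigr => q _.
by rewrite (formZl h_pos) (formZr h_pos) mulrA.
Qed.

Fixpoint orthonormal (es : seq V) : Prop :=
  if es is e :: es' then
    [/\ h e e = 1, forall e', e' \in es' -> h e' e = 0 & orthonormal es']
  else True.

Definition proj (es : seq V) (v : V) : V := \sum_(e <- es) h e v *: e.

Lemma form_proj es e v : orthonormal es -> e \in es -> h e (proj es v) = h e v.
Proof.
rewrite /proj; elim: es => // e0 es IHes [e01 e0es /IHes{}IHes].
rewrite inE big_cons (formDr h_pos) (formZr h_pos) => /predU1P[->|ees].
  rewrite e01 mulr1 (form_sumr h_pos) big_seq big1 ?addr0// => e' e'es.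
  by rewrite (formZr h_pos) (form_conj h_pos e0) e0es// rmorph0 mulr0.
by rewrite e0es// mulr0 add0r IHes.
Qed.

Lemma orthonormal_norm es (a : V -> C) : orthonormal es ->
  h (\sum_(e <- es) a e *: e) (\sum_(e <- es) a e *: e) =
  \sum_(e <- es) `|a e| ^+ 2.
Proof.
elim: es => [|e es IHes]; first by rewrite !big_nil (form0l h_pos).
move=> /= [e1 ees /IHes{}IHes]; rewrite !big_cons.
set r := \sum_(e <- es) a e *: e in IHes *.
have er : h r e = 0.
  rewrite (form_suml h_pos) big_seq big1// => e' /ees e'e.
  by rewrite (formZl h_pos) e'e mulr0.
rewrite (formDl h_pos) !(formDr h_pos) !(formZl h_pos) !(formZr h_pos) e1 er.
by rewrite (form_conj h_pos e) er rmorph0 IHes normCKC; ring.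
Qed.

(** As h may be degenerate, the vectors of s are reached only up to h-null vectors;
the family is extended by the normalised remainder r unless r is itself null. *)
Lemma gram_schmidt (s : seq V) : exists2 es, orthonormal es &
  forall v, v \in s -> h (v - proj es v) (v - proj es v) = 0.
Proof.
elim: s => [|x s [es es_on es_s]]; first by exists [::].
set r := x - proj es x; have er e : e \in es -> h e r = 0.
  by move=> ees; rewrite (formDr h_pos) (formNr h_pos) form_proj// subrr.
have [r0|r_neq0] := eqVneq (h r r) 0.
  by exists es => // v; rewrite inE => /predU1P[->|/es_s].
have n_neq0 : fnorm h r != 0 by rewrite sqrtC_eq0.
have n_real : (fnorm h r)^-1^* = (fnorm h r)^-1.
  by rewrite conj_Creal// realV ger0_real// fnorm_ge0.
pose e := (fnorm h r)^-1 *: r.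
(* The new vector is orthogonal to es, so it does not see the projections on es. *)
have e_perp e' : e' \in es -> h e' e = 0.
  by move=> /er re'; rewrite (formZr h_pos) re' mulr0.
have e_proj v : h e (proj es v) = 0.
  rewrite (form_sumr h_pos) big_seq big1// => e' /e_perp e'e.
  by rewrite (formZr h_pos) (form_conj h_pos e) e'e rmorph0 mulr0.
have ev v : h e v = h e (v - proj es v).
  by rewrite (formDr h_pos) (formNr h_pos) e_proj subr0.
exists (e :: es) => [/=|v].
  split=> //; rewrite (formZl h_pos) (formZr h_pos) n_real.
  by rewrite -(fnorm_sqr h r) expr2 mulKf// mulVf.
rewrite /proj big_cons -/(proj es v) opprD addrCA addrC inE.
case/predU1P=> [->|vs]; last first.
  have -> : h e v = 0.
    by rewrite ev (form_conj h_pos) (null_orthogonal h_pos) ?es_s// rmorph0.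
  by rewrite scale0r subr0 es_s.
rewrite ev -/r (formZl h_pos) n_real -(fnorm_sqr h r) expr2 mulKf//.
by rewrite scalerA divff// scale1r subrr (form0l h_pos).
Qed.

Lemma parseval es v w : h (v - proj es v) (v - proj es v) = 0 ->
  h v w = \sum_(e <- es) (h e v)^* * h e w.
Proof.
move=> v0; rewrite -[v in LHS](subrK (proj es v)) (formDl h_pos).
rewrite (null_orthogonal h_pos)// add0r (form_suml h_pos).
by apply: eq_bigr => e _; rewrite (formZl h_pos).
Qed.

(** Schur's product theorem: on the finitely many vectors that occur in F, Parseval
writes h as a sum of rank one kernels, and rescaling K by a function keeps it
positive. *)
Lemma psd_schur (T : Type) (g : T -> V) (K : T -> T -> C) :
  psd K -> psd (fun u v => h (g u) (g v) * K u v).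
Proof.
move=> Kp F; have [es _ es_s] := gram_schmidt [seq g p.2 | p <- F].
suff -> : qsum (fun u v => h (g u) (g v) * K u v) F =
    qsum (fun u v => \sum_(e <- es) ((h e (g u))^* * h e (g v) * K u v)) F.
  by apply: psd_sum => e; exact: psd_rescale.
apply: eq_in_qsum => p q pF _; rewrite (@parseval es) ?mulr_suml//.
exact/es_s/(mem_map_In (fun p => g p.2)).
Qed.

(** Only positivity has content. With z the sum of the conj(Lam(e, v)) e and S the
sum of the |Lam(e, v)|^2, one has h(z, z) = S = Lam(z, v), whence
S^2 <= S h(v, v) by the bound on Lam. *)
Lemma bessel (es : seq V) (Lam : V -> V -> C) :
    orthonormal es -> bilinear_for *%R *%R Lam ->
    (forall v w, `|Lam v w| ^+ 2 <= h v v * h w w) ->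
  hermitian_form (fun v w => h v w - \sum_(e <- es) (Lam e v)^* * Lam e w).
Proof.
move=> es_on Lam_bil Lam_le; split.
- split=> [w a v v'|v a w w'] /=.
    rewrite (formDl h_pos) (formZl h_pos) mulrBr mulr_sumr addrACA -opprD.
    rewrite -big_split /=; congr (_ - _); apply: eq_bigr => e _.
    by rewrite (Lam_bil.2 e a v v') /= rmorphD rmorphM /=; ring.
  rewrite (formDr h_pos) (formZr h_pos) mulrBr mulr_sumr addrACA -opprD.
  rewrite -big_split /=; congr (_ - _); apply: eq_bigr => e _.
  by rewrite (Lam_bil.2 e a w w') /=; ring.
- move=> v w; rewrite rmorphB rmorph_sum /= -(form_conj h_pos).
  by congr (_ - _); apply: eq_bigr => e _; rewrite rmorphM /= conjCK mulrC.
move=> v; set S := \sum_(e <- es) _.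
pose z := \sum_(e <- es) (Lam e v)^* *: e.
have SE : S = \sum_(e <- es) `|(Lam e v)^*| ^+ 2.
  by apply: eq_bigr => e _; rewrite norm_conjC normCKC.
have zS : h z z = S by rewrite orthonormal_norm.
have Lz : Lam z v = S.
  have L0 : Lam 0 v = 0.
    by have := Lam_bil.1 v (- 1) 0 0; rewrite scaleN1r oppr0 addr0 /= mulN1r addNr.
  rewrite /z /S; elim/big_rec2: _ => // e y2 y1 _ y12.
  by rewrite (Lam_bil.1 v (Lam e v)^* e y1) /= y12.
have S0 : 0 <= S by rewrite SE sumr_ge0// => e _; rewrite exprn_ge0.
have := Lam_le z v; rewrite Lz zS ger0_norm// expr2.
have [->|S_neq0] := eqVneq S 0; first by rewrite subr0 form_ge0.
by rewrite ler_pM2l ?subr_ge0// lt_def S_neq0.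
Qed.

End GramSchmidt.

(** * Kernels on words *)

Section WordKernels.
Variables (C : numClosedFieldType) (V : lmodType C).
Implicit Types (w : nat -> C) (h : V -> V -> C) (u v : seq V).

(** With w k = k! this is the inner product of elementary tensors. General weights
are needed because products and contractions change the normalisation of each
degree. *)
Definition word_kernel w h u v : C :=
  if size u == size v then w (size u) * \prod_(p <- zip u v) h p.1 p.2 else 0.

Lemma word_kernel_cons w h x u y v :
  word_kernel w h (x :: u) (y :: v) = h x y * word_kernel (fun n => w n.+1) h u v.
Proof.
rewrite /word_kernel /= eqSS big_cons /=.
by case: ifP => _; [rewrite mulrCA | rewrite mulr0].
Qed.

Lemma word_kernelZ (a : nat -> C) w h u v :
  word_kernel (fun n => a n * w n) h u v = a (size u) * word_kernel w h u v.
Proof. by rewrite /word_kernel; case: ifP => _; rewrite ?mulr0 ?mulrA. Qed.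

Lemma word_kernel_scale_form c w h u v :
  word_kernel w (fun x y => c * h x y) u v = word_kernel (fun n => c ^+ n * w n) h u v.
Proof.
rewrite word_kernelZ /word_kernel; case: ifP => [/eqP suv|_]; last by rewrite mulr0.
rewrite big_split /= mulrCA; congr (_ * _).
rewrite -[in RHS](minnn (size u)) [in X in minn _ X]suv -size_zip.
by elim: (zip u v) => [|p s IHs]; rewrite ?big_nil ?big_cons ?IHs ?exprS.
Qed.

Lemma word_kernel_conj w h u v : (forall n, 0 <= w n) ->
  (forall x y, h x y = (h y x)^*) -> word_kernel w h u v = (word_kernel w h v u)^*.
Proof.
move=> w0 hc; rewrite /word_kernel eq_sym; case: ifP => [/eqP suv|_]; last by rewrite rmorph0.
rewrite rmorphM rmorph_prod /= suv (conj_Creal (ger0_real (w0 _))); congr (_ * _).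
elim: u v suv => [|x u IHu] [|y v] //= => [_|[suv]]; first by rewrite !big_nil.
by rewrite !big_cons /= -hc IHu.
Qed.

(** The product over the first n letters, reading 0 beyond the end: on words of
length n it is the product kernel, and it allows an induction on n with a
fixed set of words. *)
Definition prefix_kernel n h u v : C := \prod_(i < n) h u`_i v`_i.

Lemma prefix_kernelE h u v : size u = size v ->
  \prod_(p <- zip u v) h p.1 p.2 = prefix_kernel (size u) h u v.
Proof.
elim: u v => [|x u IHu] [|y v] //= => [_|[suv]].
  by rewrite big_nil /prefix_kernel big_ord0.
by rewrite big_cons /prefix_kernel big_ord_recl /= IHu.
Qed.

(** Weights enter linearly, degree by degree, so that inequalities for word_kernel
reduce to positivity of the prefix kernels. *)
Lemma word_kernel_degrees w h N u v : (size u < N)%N -> word_kernel w h u v =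
  \sum_(n < N) w n * ((size u == n)%:R^* * (size v == n)%:R * prefix_kernel n h u v).
Proof.
move=> uN; rewrite (bigD1 (Ordinal uN)) //= big1 => [|n nu]; last first.
  suff /negbTE-> : size u != n by rewrite rmorph0 !mul0r mulr0.
  by apply: contra_neq nu => un; exact: val_inj.
rewrite eqxx rmorph1 mul1r addr0 /word_kernel eq_sym.
by case: ifP => [/eqP suv|_]; rewrite ?mul0r ?mulr0 ?mul1r// prefix_kernelE.
Qed.

Lemma qsum_word_kernel_degrees w h N F : (forall p, List.In p F -> (size p.2 < N)%N) ->
  qsum (word_kernel w h) F =
  \sum_(n < N) w n * qsum (prefix_kernel n h) [seq (p.1 * (size p.2 == n)%:R, p.2) | p <- F].
Proof.
move=> FN; under [RHS]eq_bigr => n _.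
  rewrite -(qsum_rescale (fun u => (size u == n)%:R)) -qsumZ; over.
by rewrite -qsum_sum; apply: eq_in_qsum => p q /FN pN _; exact: word_kernel_degrees.
Qed.

Lemma formal_degree (F : seq (C * seq V)) :
  exists N, forall p, List.In p F -> (size p.2 < N)%N.
Proof.
elim: F => [|p F [N FN]]; first by exists 0%N.
exists (maxn (size p.2).+1 N) => q /= [<-|/FN]; rewrite leq_max ?leqnn//.
by move->; rewrite orbT.
Qed.

Lemma psd_prefix_kernel n h : hermitian_form h -> psd (prefix_kernel n h).
Proof.
move=> h_pos; elim: n => [|n IHn].
  by apply: eq_psd (@psd1 C (seq V)) => u v; rewrite /prefix_kernel big_ord0.
apply: eq_psd (psd_schur h_pos (fun u => u`_n) IHn) => u v.
by rewrite /prefix_kernel big_ord_recr mulrC.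
Qed.

Lemma psd_word_kernel w h : (forall n, 0 <= w n) -> hermitian_form h ->
  psd (word_kernel w h).
Proof.
move=> w0 h_pos F; have [N FN] := formal_degree F.
rewrite (qsum_word_kernel_degrees _ _ FN) sumr_ge0// => n _.
by rewrite mulr_ge0// psd_prefix_kernel.
Qed.

Lemma qsum_word_kernel_le_weight w w' h F : hermitian_form h ->
  (forall n, w n <= w' n) -> qsum (word_kernel w h) F <= qsum (word_kernel w' h) F.
Proof.
move=> h_pos ww'; have [N FN] := formal_degree F.
rewrite !(qsum_word_kernel_degrees _ _ FN) ler_sum// => n _.
by rewrite ler_wpM2r// psd_prefix_kernel.
Qed.

(** With P_n and Q_n the prefix kernels of h + b and h, the difference
P_(n+1) - Q_(n+1) is b P_n + h (P_n - Q_n), where b and h are taken at the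
letters of index n; both terms are positive by Schur. *)
Lemma psd_prefix_kernel_mono n h b : hermitian_form h -> hermitian_form b ->
  hermitian_form (fun x y => h x y + b x y) ->
  psd (fun u v => prefix_kernel n (fun x y => h x y + b x y) u v - prefix_kernel n h u v).
Proof.
move=> h_pos b_pos hb_pos; elim: n => [|n IHn].
  apply: (@eq_psd _ _ (fun u v => 0 * 1)); last exact: psdZ (@psd1 _ _).
  by move=> u v; rewrite /prefix_kernel !big_ord0 subrr mul0r.
have := psdD (psd_schur b_pos (fun u => u`_n) (psd_prefix_kernel n hb_pos))
             (psd_schur h_pos (fun u => u`_n) IHn).
by apply: eq_psd => u v; rewrite /prefix_kernel !big_ord_recr /=; ring.
Qed.

Lemma qsum_word_kernel_mono w h b F : (forall n, 0 <= w n) ->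
    hermitian_form h -> hermitian_form b ->
    hermitian_form (fun x y => h x y + b x y) ->
  qsum (word_kernel w h) F <= qsum (word_kernel w (fun x y => h x y + b x y)) F.
Proof.
move=> w0 h_pos b_pos hb_pos; have [N FN] := formal_degree F.
rewrite !(qsum_word_kernel_degrees _ _ FN) ler_sum// => n _; rewrite ler_wpM2l//.
by rewrite -subr_ge0 -qsumB psd_prefix_kernel_mono.
Qed.

End WordKernels.

Lemma hermitian_formD (C : numClosedFieldType) (V : lmodType C)
    (h b : V -> V -> C) :
  hermitian_form h -> hermitian_form b ->
  hermitian_form (fun x y => h x y + b x y).
Proof.
move=> h_pos b_pos; split=> [|x y|x]; last 2 first.
- by rewrite rmorphD /= -(form_conj h_pos) -(form_conj b_pos).
- by rewrite addr_ge0 ?form_ge0.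
split=> [z a x y|z a x y] /=.
  rewrite !(formDl h_pos) !(formDl b_pos) !(formZl h_pos) !(formZl b_pos).
  by ring.
by rewrite !(formDr h_pos) !(formDr b_pos) !(formZr h_pos) !(formZr b_pos); ring.
Qed.

Lemma hermitian_formZ (C : numClosedFieldType) (V : lmodType C)
    (c : C) (h : V -> V -> C) : 0 <= c ->
  hermitian_form h -> hermitian_form (fun x y => c * h x y).
Proof.
move=> c0 h_pos; split=> [|x y|x]; last 2 first.
- by rewrite rmorphM /= -(form_conj h_pos) conj_Creal// ger0_real.
- by rewrite mulr_ge0 ?form_ge0.
split=> [z a x y|z a x y] /=.
  by rewrite (formDl h_pos) (formZl h_pos); ring.
by rewrite (formDr h_pos) (formZr h_pos); ring.
Qed.

(** * Tensors as formal sums of words *)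

Section LinearPredicate.
Variables (K : nzRingType) (U W : lmodType K) (f : U -> W).
Hypothesis f_lin : linear f.

Lemma lin0 : f 0 = 0.
Proof. by have := f_lin (- 1) 0 0; rewrite scaleN1r oppr0 addr0 scaleN1r addNr. Qed.

Lemma linD x y : f (x + y) = f x + f y.
Proof. by have := f_lin 1 x y; rewrite !scale1r. Qed.

Lemma linZ a x : f (a *: x) = a *: f x.
Proof. by have := f_lin a x 0; rewrite !addr0 lin0 addr0. Qed.

Lemma lin_sum I (r : seq I) (P : pred I) (F : I -> U) :
  f (\sum_(i <- r | P i) F i) = \sum_(i <- r | P i) f (F i).
Proof. exact: (big_morph f linD lin0). Qed.

End LinearPredicate.

Section FormalTensors.
Variables (K : fieldType) (V : lmodType K).

(** Formal sums F are unreduced representatives of tensors: norms are computed on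
them as qsum of a word kernel, which makes sense also for weights w for which no
form on the tensors has been introduced. *)
Definition eval_words (F : seq (K * seq V)) : tensor V := \sum_(p <- F) p.1 *: tens p.2.

Lemma eval_words_cons p F : eval_words (p :: F) = p.1 *: tens p.2 + eval_words F.
Proof. by rewrite /eval_words big_cons. Qed.

Lemma tensor_formal (X : tensor V) : exists F, X = eval_words F.
Proof.
pose g := repr X; exists [seq (g@_k, k) | k <- msupp g].
rewrite /eval_words big_map -(pclass_repr X) -/g [g in LHS]monalgE linear_sum.
apply: eq_bigr => k _; rewrite /tens genE /=.
have -> : << g@_k *g k >> = g@_k *: << k >> :> {malg K[seq V]}.
  apply/malgP => k'; rewrite mcoeffZ !mcoeffU.
  by case: (k == k'); rewrite ?mulr1n ?mulr1 ?mulr0n ?mulr0.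
by rewrite linearZ.
Qed.

Lemma lin_eval_words (W : lmodType K) (f : tensor V -> W) F : linear f ->
  f (eval_words F) = \sum_(p <- F) p.1 *: f (tens p.2).
Proof.
by move=> fl; rewrite /eval_words (lin_sum fl); apply: eq_bigr => p _; rewrite (linZ fl).
Qed.

Lemma tmul_eval_words F G : tmul (eval_words F) (eval_words G) =
  \sum_(p <- F) \sum_(q <- G) (p.1 * q.1) *: tens (p.2 ++ q.2) :> tensor V.
Proof.
rewrite (lin_eval_words _ (tmul_linear_l _)); apply: eq_bigr => p _.
rewrite (lin_eval_words _ (tmul_linear_r _)) scaler_sumr; apply: eq_bigr => q _.
by rewrite tmul_tens scalerA.
Qed.

(** Permuting the letters of a word does not change its symmetrisation. *)
Lemma Sym_idem (X : tensor V) : (forall n, n.+1%:R != 0 :> K) ->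
  Sym (Sym X) = Sym X.
Proof.
move=> char0; have [F ->] := tensor_formal X.
rewrite (lin_eval_words _ (@Sym_is_linear _ V)) (lin_sum (@Sym_is_linear _ V)).
apply: eq_bigr => p _; rewrite linearZ /=; congr (_ *: _).
move: (p.2) => u; pose n := size u; have un : size u = n by [].
have perm_Sym (s : {perm 'I_n}) :
    Sym (tens [seq u`_(s i) | i <- enum 'I_n]) = Sym (tens u).
  rewrite (Sym_tens_size un) (@Sym_tens_size _ _ n); last first.
    by rewrite size_map size_enum_ord.
  congr (_ *: _); rewrite [RHS](reindex_inj (mulIg s)) /=; apply: eq_bigr => r _.
  congr tens; apply: eq_map => i; rewrite permM (nth_map i) ?size_enum_ord//.
  by rewrite nth_ord_enum.
rewrite {1}(Sym_tens_size un) linearZ /= linear_sum /=.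
under eq_bigr do rewrite perm_Sym.
rewrite sumr_const card_Sn -scaler_nat scalerA mulVf ?scale1r//.
by rewrite -(prednK (fact_gt0 n)) char0.
Qed.

End FormalTensors.

(** * The inner product on the tensor algebra *)

Section WordMultilinear.
Variables (C : numClosedFieldType) (V : lmodType C) (h : V -> V -> C).
Hypothesis h_sesq : bilinear_for (conjC \; *%R) *%R h.

Lemma word_kernel_multilinear_l w v : multilinear (W := C^o) conjC (word_kernel w h ^~ v).
Proof.
move=> u a x y u'; elim: u w v => [|z u IHu] w [|z' v] /=.
- by rewrite /word_kernel /= scaler0 addr0.
- by rewrite !word_kernel_cons (h_sesq.1 z' a x y) /= mulrDl -mulrA.
- by rewrite /word_kernel /= scaler0 addr0.
- by rewrite !word_kernel_cons IHu /GRing.scale /= mulrDr mulrCA.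
Qed.

Lemma word_kernel_multilinear_r w u : multilinear (W := C^o) idfun (word_kernel w h u).
Proof.
move=> v a x y v'; elim: v w u => [|z v IHv] w [|z' u] /=.
- by rewrite /word_kernel /= scaler0 addr0.
- by rewrite !word_kernel_cons (h_sesq.2 z' a x y) /= mulrDl -mulrA.
- by rewrite /word_kernel /= scaler0 addr0.
- by rewrite !word_kernel_cons IHv /GRing.scale /= mulrDr mulrCA.
Qed.

End WordMultilinear.

Definition fact_weight (C : numClosedFieldType) (n : nat) : C := n`!%:R.

Lemma fact_weight_ge0 (C : numClosedFieldType) n : 0 <= fact_weight C n.
Proof. exact: ler0n. Qed.

(** Over R[i] this is convertible to tform. *)
Definition tensor_form (C : numClosedFieldType) (V : lmodType C) (h : V -> V -> C) :
    tensor V -> tensor V -> C :=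
  tlift2 (W := C^o) conjC (word_kernel (fact_weight C) h).

Section TensorForm.
Variables (C : numClosedFieldType) (V : lmodType C).
Variables (h : V -> V -> C).
Hypothesis h_pos : hermitian_form h.

Lemma tensor_form_tens u v : tensor_form h (tens u) (tens v) = word_kernel (fact_weight C) h u v.
Proof.
have h_sesq := form_sesq h_pos; apply: (tlift2_tens (W := C^o) (th := conjC)).
  exact: word_kernel_multilinear_l.
exact: word_kernel_multilinear_r.
Qed.

Lemma tensor_form_linear_l a (X X' Y : tensor V) :
  tensor_form h (a *: X + X') Y = a^* * tensor_form h X Y + tensor_form h X' Y.
Proof.
have h_sesq := form_sesq h_pos; move: a X X'.
apply: (tlift2_semilinear_l (W := C^o) (th := conjC)).
  exact: word_kernel_multilinear_l.
exact: word_kernel_multilinear_r.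
Qed.

Lemma tensor_form_linear_r a (X Y Y' : tensor V) :
  tensor_form h X (a *: Y + Y') = a * tensor_form h X Y + tensor_form h X Y'.
Proof.
have h_sesq := form_sesq h_pos; move: a Y Y'.
apply: (tlift2_linear_r (W := C^o) (th := conjC)).
  exact: word_kernel_multilinear_l.
exact: word_kernel_multilinear_r.
Qed.

Lemma tensor_form0l (Y : tensor V) : tensor_form h 0 Y = 0.
Proof.
have := tensor_form_linear_l (- 1) 0 0 Y.
by rewrite scaleN1r oppr0 addr0 /= rmorphN1 mulN1r addNr.
Qed.

Lemma tensor_form0r (Y : tensor V) : tensor_form h Y 0 = 0.
Proof.
by have := tensor_form_linear_r (- 1) Y 0 0; rewrite scaleN1r oppr0 addr0 /= mulN1r addNr.
Qed.

Lemma tensor_formDl (X X' Y : tensor V) :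
  tensor_form h (X + X') Y = tensor_form h X Y + tensor_form h X' Y.
Proof. by have := tensor_form_linear_l 1 X X' Y; rewrite /= rmorph1 mul1r scale1r. Qed.

Lemma tensor_formDr (X Y Y' : tensor V) :
  tensor_form h X (Y + Y') = tensor_form h X Y + tensor_form h X Y'.
Proof. by have := tensor_form_linear_r 1 X Y Y'; rewrite /= mul1r scale1r. Qed.

Lemma tensor_formZl (a : C) (X Y : tensor V) : tensor_form h (a *: X) Y = a^* * tensor_form h X Y.
Proof. by have := tensor_form_linear_l a X 0 Y; rewrite /= addr0 tensor_form0l addr0. Qed.

Lemma tensor_formZr (a : C) (X Y : tensor V) : tensor_form h X (a *: Y) = a * tensor_form h X Y.
Proof. by have := tensor_form_linear_r a X Y 0; rewrite /= addr0 tensor_form0r addr0. Qed.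

Lemma tensor_form_suml I (r : seq I) (F : I -> tensor V) Y :
  tensor_form h (\sum_(i <- r) F i) Y = \sum_(i <- r) tensor_form h (F i) Y.
Proof.
exact: (big_morph (fun X => tensor_form h X Y) (fun a b => tensor_formDl a b Y) (tensor_form0l Y)).
Qed.

Lemma tensor_form_sumr I (r : seq I) (F : I -> tensor V) X :
  tensor_form h X (\sum_(i <- r) F i) = \sum_(i <- r) tensor_form h X (F i).
Proof. exact: (big_morph (tensor_form h X) (tensor_formDr X) (tensor_form0r X)). Qed.

Lemma tensor_form_combinations I J (r : seq I) (s : seq J) a b
    (X : I -> tensor V) (Y : J -> tensor V) :
  tensor_form h (\sum_(i <- r) a i *: X i) (\sum_(j <- s) b j *: Y j) =
  \sum_(i <- r) \sum_(j <- s) (a i)^* * b j * tensor_form h (X i) (Y j).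
Proof.
rewrite tensor_form_suml; apply: eq_bigr => i _.
rewrite tensor_form_sumr; apply: eq_bigr => j _.
by rewrite tensor_formZl tensor_formZr mulrA.
Qed.

Lemma tensor_form_eval_words F G : tensor_form h (eval_words F) (eval_words G) =
  \sum_(p <- F) \sum_(q <- G) p.1^* * q.1 * word_kernel (fact_weight C) h p.2 q.2.
Proof.
rewrite tensor_form_combinations; apply: eq_bigr => p _; apply: eq_bigr => q _.
by rewrite tensor_form_tens.
Qed.

Lemma tensor_form_qsum F :
  tensor_form h (eval_words F) (eval_words F) = qsum (word_kernel (fact_weight C) h) F.
Proof. exact: tensor_form_eval_words. Qed.

Lemma tensor_form_hermitian : hermitian_form (tensor_form h).
Proof.
split.
  by split=> [Y a X X'|X a Y Y']; [exact: tensor_form_linear_l | exact: tensor_form_linear_r].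
  move=> X Y; have [F ->] := tensor_formal X; have [G ->] := tensor_formal Y.
  rewrite !tensor_form_eval_words rmorph_sum exchange_big; apply: eq_bigr => q _ /=.
  rewrite rmorph_sum; apply: eq_bigr => p _ /=.
  rewrite !rmorphM /= conjCK [q.1 * _]mulrC; congr (_ * _).
  apply: word_kernel_conj; first exact: fact_weight_ge0.
  exact: form_conj.
move=> X; have [F ->] := tensor_formal X; rewrite tensor_form_qsum.
by apply: psd_word_kernel => //; exact: fact_weight_ge0.
Qed.

End TensorForm.

(** The seminorms are thus directed: a finite intersection of balls contains the
ball of the sum of the forms. *)
Lemma tensor_form_mono (C : numClosedFieldType) (V : lmodType C) (h b : V -> V -> C) X :
  hermitian_form h -> hermitian_form b ->
  tensor_form h X X <= tensor_form (fun x y => h x y + b x y) X X.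
Proof.
move=> h_pos b_pos; have hb_pos := hermitian_formD h_pos b_pos.
have [F ->] := tensor_formal X; rewrite !tensor_form_qsum//.
by apply: qsum_word_kernel_mono => //; exact: fact_weight_ge0.
Qed.

(** * Symmetrisation is an orthogonal projection *)

Section SymContraction.
Variables (C : numClosedFieldType) (V : lmodType C) (h : V -> V -> C).
Hypothesis h_pos : hermitian_form h.

Let tensor_pos := tensor_form_hermitian h_pos.

Lemma word_kernel_prefix_kernel u v n : size u = n -> size v = n ->
  word_kernel (fact_weight C) h u v = n`!%:R * \prod_(i < n) h u`_i v`_i.
Proof. by move=> <- vu; rewrite /word_kernel vu eqxx prefix_kernelE. Qed.

(** The product of the h(u_(s i), v_i) over i equals the product of the
h(u_i, v_(s^-1 i)); the sum over s is then reindexed by inversion. *)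
Lemma Sym_selfadjoint_tens (u v : seq V) :
  tensor_form h (Sym (tens u)) (tens v) = tensor_form h (tens u) (Sym (tens v)).
Proof.
set n := size u; have un : size u = n by [].
have psize m (s : {perm 'I_m}) (a : seq V) : size [seq a`_(s i) | i <- enum 'I_m] = m.
  by rewrite size_map size_enum_ord.
have pnth m (s : {perm 'I_m}) (a : seq V) (i : 'I_m) :
    [seq a`_(s i) | i <- enum 'I_m]`_i = a`_(s i).
  by rewrite (nth_map i) ?size_enum_ord// nth_ord_enum.
have [vn|vn] := eqVneq (size v) n; last first.
  rewrite (Sym_tens_size un) (Sym_tens_size (erefl (size v))).
  rewrite tensor_formZl// tensor_formZr//.
  rewrite tensor_form_suml// tensor_form_sumr//.
  rewrite !big1 ?mulr0// => s _; rewrite tensor_form_tens//.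
    by rewrite /word_kernel psize -/n eq_sym (negbTE vn).
  by rewrite /word_kernel psize -/n eq_sym (negbTE vn).
rewrite (Sym_tens_size un) (Sym_tens_size vn).
rewrite tensor_formZl// tensor_formZr//.
rewrite fmorphV /= conjC_nat; congr (_ * _).
rewrite tensor_form_suml// tensor_form_sumr// [RHS](reindex_inj (@invg_inj {perm 'I_n})) /=.
apply: eq_bigr => s _; rewrite !tensor_form_tens//.
rewrite !(@word_kernel_prefix_kernel _ _ n) ?psize//; congr (_ * _).
rewrite [RHS](reindex_inj (@perm_inj _ s)); apply: eq_bigr => i _ /=.
by rewrite !pnth permK.
Qed.

Lemma Sym_selfadjoint X Y : tensor_form h (Sym X) Y = tensor_form h X (Sym Y).
Proof.
have [F ->] := tensor_formal X; have [G ->] := tensor_formal Y.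
rewrite !(lin_eval_words _ (@Sym_is_linear _ V)) {2}/eval_words {1}/eval_words.
rewrite [LHS]tensor_form_combinations// [RHS]tensor_form_combinations//.
apply: eq_bigr => p _; apply: eq_bigr => q _.
by rewrite Sym_selfadjoint_tens.
Qed.

(** For a selfadjoint idempotent, <SX|SX> = <X|SX>, and Cauchy-Schwarz gives
||SX||^2 <= ||X|| ||SX||. *)
Lemma fnorm_Sym X : fnorm (tensor_form h) (Sym X) <= fnorm (tensor_form h) X.
Proof.
have n0 := @fnorm_ge0 _ _ _ tensor_pos.
have [->|S0] := eqVneq (fnorm (tensor_form h) (Sym X)) 0; first exact: n0.
have Spos : 0 < fnorm (tensor_form h) (Sym X) by rewrite lt_def S0 n0.
have char0 n : n.+1%:R != 0 :> C by rewrite pnatr_eq0.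
rewrite -(ler_pM2r Spos) -expr2 fnorm_sqr.
rewrite Sym_selfadjoint Sym_idem ?char0//.
apply: le_trans (cauchy_schwarz_fnorm tensor_pos X (Sym X)).
have -> : tensor_form h X (Sym X) = tensor_form h (Sym X) (Sym X).
  by rewrite Sym_selfadjoint Sym_idem.
by rewrite ger0_norm ?form_ge0.
Qed.

End SymContraction.

(** * The tensor product of two tensors *)

Lemma bin_le_exp2 n m : ('C(n, m) <= 2 ^ n)%N.
Proof.
elim: n m => [|n IHn] [|m]; rewrite ?bin0 ?expn_gt0// expnS mul2n -addnn.
by rewrite binS leq_add.
Qed.

Lemma fact_add_le k l : ((k + l)`! <= 2 ^ (k + l) * (k`! * l`!))%N.
Proof.
by rewrite -(bin_fact (leq_addr l k)) addKn leq_mul2r bin_le_exp2 orbT.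
Qed.

Section ProductBound.
Variables (C : numClosedFieldType) (V : lmodType C) (h : V -> V -> C).
Hypothesis h_pos : hermitian_form h.

Let tensor_pos := tensor_form_hermitian h_pos.

Definition degree_part k (F : seq (C * seq V)) :=
  [seq (p.1 * (size p.2 == k)%:R, p.2) | p <- F].

(** The factor 2^(k+1) 2^(l+1) comes from splitting both arguments into degrees by
form_sum_geometric, and 2^(k+l) from (k + l)! <= 2^(k+l) k! l!; their product
separates as (2 . 4^k) (2 . 4^l). *)
Definition prod_weight n : C := 2 * 4 ^+ n * n`!%:R.

Lemma prod_weight_ge0 n : 0 <= prod_weight n.
Proof. by rewrite !mulr_ge0 ?exprn_ge0 ?ler0n. Qed.

Lemma prod_weight_mul k l :
  2 ^+ k.+1 * 2 ^+ l.+1 * (k + l)`!%:R <= prod_weight k * prod_weight l.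
Proof.
have := fact_add_le k l; rewrite expnD => H.
have pow4 n : (4 ^ n = 2 ^ n * 2 ^ n)%N by rewrite -expnMn.
rewrite /prod_weight -!natrX -!natrM ler_nat !expnS !pow4.
apply: leq_trans (leq_mul (leqnn _) H) _; rewrite leq_eqVlt; apply/orP; left.
by apply/eqP; lia.
Qed.

Lemma eval_words_degree_part N F : (forall p, List.In p F -> (size p.2 < N)%N) ->
  eval_words F = \sum_(k < N) eval_words (degree_part k F).
Proof.
elim: F => [|p F IHF] FN.
  by rewrite /eval_words big_nil big1// => k _; rewrite /= big_nil.
rewrite eval_words_cons IHF => [|q qF]; last by apply: FN; right.
have pN : (size p.2 < N)%N by apply: FN; left.
under [RHS]eq_bigr do rewrite /= eval_words_cons /=.
rewrite big_split /=; congr (_ + _).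
rewrite (bigD1 (Ordinal pN))//= eqxx mulr1 big1 ?addr0// => k kp.
suff /negbTE-> : size p.2 != k by rewrite mulr0 scale0r.
by apply: contra_neq kp => pk; exact: val_inj.
Qed.

Lemma word_kernel_fact_cat k l u u' v v' :
    size u = k -> size u' = k -> size v = l -> size v' = l ->
  word_kernel (fact_weight C) h (u ++ v) (u' ++ v') =
  (k + l)`!%:R * (prefix_kernel k h u u' * prefix_kernel l h v v').
Proof.
move=> uk u'k vl v'l; rewrite /word_kernel !size_cat uk u'k vl v'l eqxx.
rewrite zip_cat ?uk ?u'k// big_cat /= !prefix_kernelE ?uk ?u'k ?vl ?v'l//.
Qed.

Lemma tensor_form_tmul F G :
  tensor_form h (tmul (eval_words F) (eval_words G)) (tmul (eval_words F) (eval_words G)) =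
  \sum_(p <- F) \sum_(p' <- F) \sum_(q <- G) \sum_(q' <- G)
    (p.1 * q.1)^* * (p'.1 * q'.1) *
    word_kernel (fact_weight C) h (p.2 ++ q.2) (p'.2 ++ q'.2).
Proof.
rewrite tmul_eval_words tensor_form_suml//; apply: eq_bigr => p _.
rewrite tensor_form_sumr//; apply: eq_bigr => p' _.
rewrite tensor_form_combinations//; apply: eq_bigr => q _; apply: eq_bigr => q' _.
by rewrite tensor_form_tens.
Qed.

Lemma tensor_form_tmul_degree k l F G :
  tensor_form h (tmul (eval_words (degree_part k F)) (eval_words (degree_part l G)))
          (tmul (eval_words (degree_part k F)) (eval_words (degree_part l G))) =
  (k + l)`!%:R * (qsum (prefix_kernel k h) (degree_part k F) *
                  qsum (prefix_kernel l h) (degree_part l G)).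
Proof.
rewrite tensor_form_tmul /qsum !big_map mulr_suml mulr_sumr; apply: eq_bigr => p _.
rewrite !big_map mulr_suml mulr_sumr; apply: eq_bigr => p' _.
rewrite !big_map !mulr_sumr; apply: eq_bigr => q _.
rewrite !big_map !mulr_sumr; apply: eq_bigr => q' _ /=.
have [pk|_] := eqVneq (size p.2) k; last by rewrite !(mulr0, mul0r, rmorph0).
have [p'k|_] := eqVneq (size p'.2) k; last by rewrite !(mulr0, mul0r, rmorph0).
have [ql|_] := eqVneq (size q.2) l; last by rewrite !(mulr0, mul0r, rmorph0).
have [q'l|_] := eqVneq (size q'.2) l; last by rewrite !(mulr0, mul0r, rmorph0).
by rewrite (@word_kernel_fact_cat k l)// !rmorphM /=; ring.
Qed.

(** For homogeneous tensors the square norm of the product is exactly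
multiplicative up to the factorials; the sums over degrees are handled by
geometric weights. *)
Lemma tensor_form_tmul_le F G :
  tensor_form h (tmul (eval_words F) (eval_words G)) (tmul (eval_words F) (eval_words G)) <=
  qsum (word_kernel prod_weight h) F * qsum (word_kernel prod_weight h) G.
Proof.
have [N FN] := formal_degree F; have [M GM] := formal_degree G.
rewrite {1 2}(eval_words_degree_part FN) (lin_sum (tmul_linear_l _)).
apply: le_trans (form_sum_geometric tensor_pos _) _.
rewrite (qsum_word_kernel_degrees _ _ FN) mulr_suml ler_sum// => k _.
rewrite -/(degree_part k F) {1 2}(eval_words_degree_part GM) (lin_sum (tmul_linear_r _)).
apply: le_trans (ler_wpM2l (exprn_ge0 _ (ler0n _ _))
  (form_sum_geometric tensor_pos _)) _.
rewrite (qsum_word_kernel_degrees _ _ GM) mulr_sumr [leRHS]mulr_sumr ler_sum// => l _.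
rewrite -/(degree_part l G) tensor_form_tmul_degree.
set a := qsum _ _; set b := qsum _ _.
have a0 : 0 <= a by exact: psd_prefix_kernel.
have b0 : 0 <= b by exact: psd_prefix_kernel.
have := ler_wpM2r (mulr_ge0 a0 b0) (prod_weight_mul k l).
by congr (_ <= _); ring.
Qed.

End ProductBound.

(** * The contraction operator on formal sums *)

Section Contraction.
Variables (K : fieldType) (V : lmodType K) (Lam : V -> V -> K).
Hypothesis Lam_bilin : bilinear_for *%R *%R Lam.
Implicit Types (F G : seq (K * seq V)) (u w : seq V).

(** The left factor is stored with reversed words, so that P_op removes the head of
the words on both sides. *)
Definition eval_words_rev F : tensor V := eval_words [seq (p.1, rev p.2) | p <- F].

Lemma eval_words_revE F : eval_words_rev F = \sum_(p <- F) p.1 *: tens (rev p.2).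
Proof. by rewrite /eval_words_rev /eval_words big_map. Qed.

Lemma tensor_formal_rev (X : tensor V) : exists F, X = eval_words_rev F.
Proof.
have [F ->] := tensor_formal X; exists [seq (p.1, rev p.2) | p <- F].
rewrite /eval_words_rev -map_comp; congr eval_words; rewrite -[LHS]map_id.
by apply: eq_map => p /=; rewrite revK -surjective_pairing.
Qed.

Lemma contract_rev u w : contract Lam (rev u) w =
  ((size u * size w)%:R * Lam (head 0 u) (head 0 w)) *:
    otens (tens (rev (behead u))) (tens (behead w)).
Proof.
case: u => [|x u]; first by rewrite contract0l !mul0r scale0r.
case: w => [|y w]; first by rewrite contract0r muln0 mul0r scale0r.
by rewrite rev_cons contract_rcons_cons size_rev.
Qed.

Lemma otens_eval_words F G : otens (eval_words_rev F) (eval_words G) =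
  \sum_(p <- F) \sum_(q <- G) (p.1 * q.1) *: otens (tens (rev p.2)) (tens q.2).
Proof.
rewrite eval_words_revE (lin_sum (otens_linear_l _)); apply: eq_bigr => p _.
rewrite (linZ (otens_linear_l _)) (lin_eval_words _ (otens_linear_r _)) scaler_sumr.
by apply: eq_bigr => q _; rewrite scalerA.
Qed.

Lemma P_op_eval_words F G : P_op Lam (otens (eval_words_rev F) (eval_words G)) =
  \sum_(p <- F) \sum_(q <- G)
    (p.1 * q.1 * ((size p.2 * size q.2)%:R * Lam (head 0 p.2) (head 0 q.2))) *:
      otens (tens (rev (behead p.2))) (tens (behead q.2)).
Proof.
have Pl := P_op_linear Lam_bilin.
rewrite otens_eval_words (lin_sum Pl); apply: eq_bigr => p _.
rewrite (lin_sum Pl); apply: eq_bigr => q _.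
by rewrite (linZ Pl) (P_op_otens Lam_bilin) contract_rev [LHS]scalerA.
Qed.

(** The functional phi applied to the head of each word, with the factor k of the
contraction in degree k. The empty word gets the coefficient 0, whatever the
default head is. *)
Definition contract_by (phi : V -> K) F :=
  [seq (p.1 * ((size p.2)%:R * phi (head 0 p.2)), behead p.2) | p <- F].

(** A decomposition of Lam on the letters that occur turns P_op into a sum of
operators acting separately on the two factors. *)
Lemma P_op_split (es : seq V) (phi : V -> V -> K) F G :
    (forall p q, List.In p F -> Lam (head 0 p.2) (head 0 q) =
      \sum_(e <- es) phi e (head 0 p.2) * Lam e (head 0 q)) ->
  P_op Lam (otens (eval_words_rev F) (eval_words G)) =
  \sum_(e <- es) otens (eval_words_rev (contract_by (phi e) F))
                       (eval_words (contract_by (Lam e) G)).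
Proof.
move=> LamE; rewrite P_op_eval_words.
under [RHS]eq_bigr do rewrite otens_eval_words big_map.
rewrite [RHS]exchange_big; elim: F LamE => [|p F IHF] LamE; first by rewrite !big_nil.
rewrite !big_cons IHF => [|p' q p'F]; last by apply: LamE; right.
congr (_ + _); under [RHS]eq_bigr do rewrite big_map.
rewrite [RHS]exchange_big; apply: eq_bigr => q _.
rewrite LamE; last by left.
rewrite !mulr_sumr scaler_suml; apply: eq_bigr => e _.
rewrite natrM /= [in LHS](_ : _ * _ = p.1 * ((size p.2)%:R * phi e (head 0 p.2)) *
  (q.1 * ((size q.2)%:R * Lam e (head 0 q.2))))//.
by ring.
Qed.

Lemma iter_P_op_linear t : linear (iter t (P_op Lam)).
Proof. by elim: t => [//|t IHt] a X Y; rewrite !iterSr (P_op_linear Lam_bilin) IHt. Qed.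

Lemma iter_P_op_words t u w : (size u < t)%N ->
  iter t (P_op Lam) (otens (tens (rev u)) (tens w)) = 0.
Proof.
elim: t u w => // t IHt [|x u] w; rewrite iterSr (P_op_otens Lam_bilin) contract_rev.
  by rewrite !mul0r scale0r (lin0 (iter_P_op_linear t)).
by rewrite ltnS => ut; rewrite (linZ (iter_P_op_linear t)) IHt// scaler0.
Qed.

(** Each contraction shortens the words of the left factor. *)
Lemma iter_P_op_vanish (X Y : tensor V) :
  exists N, forall t, (N <= t)%N -> iter t (P_op Lam) (otens X Y) = 0.
Proof.
have [F ->] := tensor_formal_rev X; have [G ->] := tensor_formal Y.
elim: F => [|p F [N FN]].
  exists 0%N => t _; rewrite otens_eval_words big_nil; exact: lin0 (iter_P_op_linear t).
exists (maxn (size p.2).+1 N) => t; rewrite geq_max => /andP[pt Nt].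
rewrite otens_eval_words big_cons (linD (iter_P_op_linear t)) -otens_eval_words FN// addr0.
rewrite (lin_sum (iter_P_op_linear t)) big1// => q _.
by rewrite (linZ (iter_P_op_linear t)) iter_P_op_words// scaler0.
Qed.

Definition star_term (X Y : tensor V) t : tensor V :=
  t`!%:R^-1 *: Sym (olift (@tmul _ V) (iter t (P_op Lam) (otens X Y))).

Lemma olift_tmul_linear : linear (olift (@tmul _ V)).
Proof. by apply: olift_linear; [exact: tmul_linear_l|exact: tmul_linear_r]. Qed.

Lemma val_scale_mu_vee a Z :
  symtensor_val (a *: mu_vee Z) = a *: Sym (olift (@tmul _ V) Z).
Proof. by []. Qed.

Lemma star_finite (X Y : symtensor V) : exists N0, forall N, (N0 <= N)%N ->
  symtensor_val (star Lam X Y) = \sum_(t < N) star_term X Y t.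
Proof.
have [N0 vanish] := iter_P_op_vanish X Y; exists N0 => N N0N.
have smD : {morph @symtensor_val _ V : A B / A + B} by [].
rewrite /star (@fsbigE _ _ _ _ _ (iota 0 N)) ?iota_uniq//; last first.
  move=> t _; rewrite mem_iota add0n /= -leqNgt => Nt.
  apply: val_inj; rewrite [LHS]val_scale_mu_vee vanish ?(leq_trans N0N)//.
  by rewrite (lin0 olift_tmul_linear) (lin0 (@Sym_is_linear _ V)) scaler0.
rewrite -(big_mkord xpredT (star_term X Y)) /index_iota subn0.
rewrite (big_morph _ smD (erefl : symtensor_val 0 = 0)).
by apply: eq_big => [t|t _]; [rewrite classical_sets.in_setT|rewrite val_scale_mu_vee].
Qed.

End Contraction.

(** * Square norms under contraction *)

Section ContractionBound.
Variables (C : numClosedFieldType) (V : lmodType C).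
Variables (h : V -> V -> C) (Lam : V -> V -> C).
Hypothesis h_pos : hermitian_form h.
Hypothesis Lam_bilin : bilinear_for *%R *%R Lam.
Hypothesis Lam_le : forall v w, `|Lam v w| ^+ 2 <= h v v * h w w.
Implicit Types (F G : seq (C * seq V)) (w : nat -> C) (u v : seq V).

(** The weight for which contraction is isometric: contracting a word of length n
multiplies it by n, so its square norm by n^2, and leaves a word of length
n - 1. For n = 0 the factor n^2 makes the value of w at the truncated
predecessor irrelevant. *)
Definition shift_weight w n : C := n%:R ^+ 2 * w n.-1.

Lemma word_kernel_shift (f : V -> V -> C) w u v : word_kernel (shift_weight w) f u v =
  (size u)%:R^* * (size v)%:R * (f (head 0 u) (head 0 v) * word_kernel w f (behead u) (behead v)).
Proof.
rewrite conjC_nat; case: u v => [|x u] [|y v].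
- by rewrite /word_kernel /= /shift_weight expr0n /= !mul0r.
- by rewrite {1}/word_kernel /= !mul0r.
- by rewrite {1}/word_kernel /= mulr0 !mul0r.
rewrite word_kernel_cons /= (word_kernelZ (fun n => n.+1%:R ^+ 2)).
have [uv|uv] := eqVneq (size u) (size v); first by rewrite uv expr2; ring.
by rewrite /word_kernel (negbTE uv) !mulr0.
Qed.

Lemma qsum_contract_by (phi : V -> C) w F :
  qsum (word_kernel w h) (contract_by phi F) =
  qsum (fun u v => (size u)%:R^* * (size v)%:R *
    ((phi (head 0 u))^* * phi (head 0 v) * word_kernel w h (behead u) (behead v))) F.
Proof.
rewrite /qsum big_map; apply: eq_bigr => p _.
rewrite big_map; apply: eq_bigr => q _ /=.
by rewrite !rmorphM /=; ring.
Qed.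

(** Parseval, for the heads of the words of F, inside the quadratic form. *)
Lemma qsum_contract_orthonormal w es F :
    (forall p, List.In p F -> h (head 0 p.2 - proj h es (head 0 p.2))
      (head 0 p.2 - proj h es (head 0 p.2)) = 0) ->
  \sum_(e <- es) qsum (word_kernel w h) (contract_by (h e) F) =
  qsum (word_kernel (shift_weight w) h) F.
Proof.
move=> esF; under eq_bigr do rewrite qsum_contract_by.
rewrite -qsum_sum; apply: eq_in_qsum => p q pF _.
rewrite -mulr_sumr -mulr_suml word_kernel_shift.
by rewrite (parseval h_pos (head 0 q.2) (esF _ pF)).
Qed.

(** The difference of the two sides is the quadratic form of the Bessel kernel of
the heads times the word kernel of the tails, positive by Schur. *)
Lemma qsum_contract_bessel w es F : (forall n, 0 <= w n) -> orthonormal h es ->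
  \sum_(e <- es) qsum (word_kernel w h) (contract_by (Lam e) F) <=
  qsum (word_kernel (shift_weight w) h) F.
Proof.
move=> w0 es_on; under eq_bigr do rewrite qsum_contract_by.
rewrite -qsum_sum -subr_ge0 -qsumB.
have bes := bessel h_pos es_on Lam_bilin Lam_le.
have := psd_rescale (fun u => (size u)%:R)
  (psd_schur bes (head 0) (psd_comp behead (psd_word_kernel w0 h_pos))).
move=> /(_ F); congr (_ <= _); apply: eq_qsum => u v.
by rewrite -mulr_sumr -mulr_suml word_kernel_shift mulrBl mulrBr.
Qed.

(** The remainder of x is h-null, so the bound on Lam makes it invisible to Lam. *)
Lemma Lam_expand es x y : h (x - proj h es x) (x - proj h es x) = 0 ->
  Lam x y = \sum_(e <- es) h e x * Lam e y.
Proof.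
move=> x0.
have L0 (v : V) : Lam 0 v = 0.
  by have := Lam_bilin.1 v (- 1) 0 0; rewrite scaleN1r oppr0 addr0 /= mulN1r addNr.
have LD (v a b : V) : Lam (a + b) v = Lam a v + Lam b v.
  by have := Lam_bilin.1 v 1 a b; rewrite scale1r /= mul1r.
rewrite -[x in LHS](subrK (proj h es x)) LD.
have -> : Lam (x - proj h es x) y = 0.
  have := Lam_le (x - proj h es x) y; rewrite x0 mul0r.
  by rewrite -normrX normr_le0 expf_eq0 => /eqP.
rewrite add0r /proj; elim/big_rec2: _ => // e y2 y1 _ y12.
by rewrite (Lam_bilin.1 y (h e x) e y1) /= y12.
Qed.

(** A bound on Z as a sum of F_i (x) G_i with controlled sums of squares. By
Cauchy-Schwarz it controls the sum of the ||F_i|| ||G_i||, and sums of squares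
are what Parseval and Bessel control under P_op. *)
Definition otensor_bounded w a b (Z : otensor (tensor V) (tensor V)) : Prop :=
  exists ps : seq (seq (C * seq V) * seq (C * seq V)),
    [/\ Z = \sum_(p <- ps) otens (eval_words_rev p.1) (eval_words p.2),
        \sum_(p <- ps) qsum (word_kernel w h) p.1 <= a
      & \sum_(p <- ps) qsum (word_kernel w h) p.2 <= b].

(** Each pair (F, G) is replaced by the pairs of contractions along an orthonormal
family adapted to the heads of F. *)
Lemma P_op_bounded w a b Z : (forall n, 0 <= w n) ->
  otensor_bounded (shift_weight w) a b Z -> otensor_bounded w a b (P_op Lam Z).
Proof.
move=> w0 [ps [-> psa psb]]; have Pl := P_op_linear Lam_bilin.
suff [qs [E qsa qsb]] : otensor_bounded w
    (\sum_(p <- ps) qsum (word_kernel (shift_weight w) h) p.1)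
    (\sum_(p <- ps) qsum (word_kernel (shift_weight w) h) p.2)
    (P_op Lam (\sum_(p <- ps) otens (eval_words_rev p.1) (eval_words p.2))).
  by exists qs; split=> //; [exact: le_trans psa|exact: le_trans psb].
elim: ps {psa psb} => [|[F G] ps [qs [E qsa qsb]]].
  by exists [::]; rewrite !big_nil (lin0 Pl); split.
have [es es_on es_s] := gram_schmidt h_pos [seq head 0 p.2 | p <- F].
have esF p : List.In p F -> h (head 0 p.2 - proj h es (head 0 p.2))
    (head 0 p.2 - proj h es (head 0 p.2)) = 0.
  by move=> pF; exact/es_s/(mem_map_In (fun p => head 0 p.2)).
exists ([seq (contract_by (h e) F, contract_by (Lam e) G) | e <- es] ++ qs).
rewrite !big_cat !big_cons !big_map /= (linD Pl) E; split.
- rewrite (P_op_split Lam_bilin (es := es) (phi := h))// => p q pF.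
  exact/Lam_expand/esF.
- by rewrite lerD// qsum_contract_orthonormal.
- by rewrite lerD// qsum_contract_bessel.
Qed.

Lemma iter_P_op_bounded t w a b Z : (forall n, 0 <= w n) ->
  otensor_bounded (iter t shift_weight w) a b Z ->
  otensor_bounded w a b (iter t (P_op Lam) Z).
Proof.
move=> w0; elim: t Z => [//|t IHt] Z /P_op_bounded bZ.
rewrite iterSr; apply: IHt; apply: bZ => n {Z}.
by elim: t n => //= t IHt n; rewrite mulr_ge0 ?exprn_ge0.
Qed.

Lemma iter_shift_weight t w n :
  iter t shift_weight w n = (n ^_ t)%:R ^+ 2 * w (n - t)%N.
Proof.
elim: t n => [|t IHt] n; first by rewrite ffactn0 expr1n mul1r subn0.
rewrite iterS {1}/shift_weight IHt mulrA -exprMn -natrM ffactnS.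
by have -> : (n.-1 - t = n - t.+1)%N by lia.
Qed.

(** For t <= n, with (n)_t the falling factorial, the left side is
(n)_t^2 . 2 . 4^(n-t) (n-t)! = 2 . 4^(n-t) C(n,t) t! n!, and C(n,t) <= 2^n. *)
Lemma iter_prod_weight_le t n : iter t shift_weight (@prod_weight C) n <=
  (2 * t`!%:R / 4 ^+ t) * (8 ^+ n * fact_weight C n).
Proof.
rewrite iter_shift_weight; have [tn|nt] := leqP t n; last first.
  by rewrite ffact_small// expr0n mul0r !mulr_ge0 ?invr_ge0 ?exprn_ge0 ?ler0n.
rewrite -(@ler_pM2r _ (4 ^+ t)) ?exprn_gt0 ?ltr0n//.
rewrite [leRHS](_ : _ = (2 * t`! * (8 ^ n * n`!))%:R); last first.
  rewrite !natrM !natrX /fact_weight.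
  by field; rewrite expf_neq0// pnatr_eq0.
rewrite /prod_weight -!natrX -!natrM ler_nat.
rewrite [X in (X <= _)%N](_ : _ =
    2 * (n ^_ t * (n ^_ t * (n - t)`!)) * 4 ^ n)%N; last first.
  have -> : (4 ^ n = 4 ^ (n - t) * 4 ^ t)%N by rewrite -expnD subnK.
  by rewrite -mulnn; move: (n ^_ t) (4 ^ (n - t))%N (4 ^ t)%N => A B D; lia.
have -> : (8 ^ n = 2 ^ n * 4 ^ n)%N by rewrite -expnMn.
rewrite ffact_fact// -bin_ffact.
by have := leq_mul (bin_le_exp2 n t) (leqnn (2 * t`! * n`! * 4 ^ n)); lia.
Qed.

End ContractionBound.

(** * Continuity estimate for the star product *)

Lemma word_kernel_rev (C : numClosedFieldType) (V : lmodType C) (h : V -> V -> C) w u v :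
  word_kernel w h (rev u) (rev v) = word_kernel w h u v.
Proof.
rewrite /word_kernel !size_rev; case: ifP => // /eqP uv.
by rewrite -rev_zip// big_rev.
Qed.

(** The inequality of arithmetic and geometric means for k x and y / k. *)
Lemma sqrtC_mul_le (C : numClosedFieldType) (k x y : C) :
  0 < k -> 0 <= x -> 0 <= y -> sqrtC (x * y) <= (k * x + k^-1 * y) / 2.
Proof.
move=> k0 x0 y0; have k_neq0 : k != 0 by rewrite gt_eqF.
have kx0 : 0 <= k * x by rewrite mulr_ge0// ltW.
have ky0 : 0 <= k^-1 * y by rewrite mulr_ge0// invr_ge0 ltW.
have -> : x * y = (k * x) * (k^-1 * y) by rewrite mulrACA divff// mul1r.
rewrite sqrtCM ?nnegrE// ler_pdivlMr ?ltr0n// -subr_ge0.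
rewrite -[k * x in X in _ <= X]sqrtCK -[k^-1 * y in X in _ <= X]sqrtCK.
have : sqrtC (k * x) - sqrtC (k^-1 * y) \is Num.real.
  by rewrite realB ?ger0_real ?sqrtC_ge0.
by rewrite realEsqr sqrrB !sqrtCK; congr (_ <= _); ring.
Qed.

Lemma sum_geometric_le (C : numClosedFieldType) N :
  \sum_(t < N) (2 / 4 ^+ t : C) <= 4.
Proof.
suff: \sum_(t < N) (2 / 4 ^+ t : C) <= 4 - 4 / 4 ^+ N.
  by move/le_trans; apply; rewrite gerBl divr_ge0 ?exprn_ge0 ?ler0n.
elim: N => [|N IHN]; first by rewrite big_ord0 expr0 divr1 subrr.
rewrite big_ord_recr /=; apply: le_trans (lerD IHN (lexx _)) _.
have f4 : 4 ^+ N != 0 :> C by rewrite expf_neq0// pnatr_eq0.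
have -> : 4 - 4 / 4 ^+ N + 2 / 4 ^+ N = 4 - 2 / 4 ^+ N :> C by field.
rewrite lerD2l lerN2 exprS invfM mulrA divff ?pnatr_eq0//.
by rewrite ler_wpM2r ?invr_ge0 ?exprn_ge0 ?ler0n// ler1n.
Qed.

Section StarBound.
Variables (C : numClosedFieldType) (V : lmodType C).
Variables (h : V -> V -> C) (Lam : V -> V -> C).
Hypothesis h_pos : hermitian_form h.
Hypothesis Lam_bilin : bilinear_for *%R *%R Lam.
Hypothesis Lam_le : forall v w, `|Lam v w| ^+ 2 <= h v v * h w w.

Let tensor_pos := tensor_form_hermitian h_pos.

Lemma qsum_rev w F :
  qsum (word_kernel w h) [seq (p.1, rev p.2) | p <- F] = qsum (word_kernel w h) F.
Proof.
by rewrite -(qsum_comp (@rev V)); apply: eq_qsum => u v; exact: word_kernel_rev.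
Qed.

Lemma fnorm_tmul_le F G : fnorm (tensor_form h) (tmul (eval_words_rev F) (eval_words G)) <=
  sqrtC (qsum (word_kernel (@prod_weight C) h) F * qsum (word_kernel (@prod_weight C) h) G).
Proof.
have q0 H : 0 <= qsum (word_kernel (@prod_weight C) h) H.
  by apply: psd_word_kernel => //; exact: prod_weight_ge0.
rewrite /fnorm ler_sqrtC ?nnegrE ?form_ge0 ?mulr_ge0//.
by apply: le_trans (tensor_form_tmul_le h_pos _ _) _; rewrite qsum_rev.
Qed.

(** The arithmetic-geometric mean inequality with ratio r / s balances the two
sums of squares; this is where s and r have to be positive. *)
Lemma otensor_bounded_fnorm c s r Z : 0 < s -> 0 < r ->
    otensor_bounded h (@prod_weight C) (c * s ^+ 2) (c * r ^+ 2) Z ->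
  fnorm (tensor_form h) (olift (@tmul _ V) Z) <= c * s * r.
Proof.
move=> s0 r0 [ps [-> psa psb]].
have s_neq0 : s != 0 by rewrite gt_eqF.
have r_neq0 : r != 0 by rewrite gt_eqF.
have rs0 : 0 < r / s by rewrite divr_gt0.
rewrite (lin_sum (@olift_tmul_linear _ V)).
apply: le_trans (fnorm_sum tensor_pos _ _ _) _.
apply: (@le_trans _ _ (\sum_(p <- ps) (r / s * qsum (word_kernel (@prod_weight C) h) p.1 +
    (r / s)^-1 * qsum (word_kernel (@prod_weight C) h) p.2) / 2)).
  apply: ler_sum => p _.
  rewrite olift_otens; [|exact: tmul_linear_l|exact: tmul_linear_r].
  apply: le_trans (fnorm_tmul_le _ _) _; apply: sqrtC_mul_le => //.
    by apply: psd_word_kernel => //; exact: prod_weight_ge0.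
  by apply: psd_word_kernel => //; exact: prod_weight_ge0.
rewrite -mulr_suml big_split /= -!mulr_sumr ler_pdivrMr ?ltr0n//.
apply: le_trans (lerD (ler_wpM2l (ltW rs0) psa) (ler_wpM2l _ psb)) _.
  by rewrite invr_ge0 ltW.
by rewrite le_eqVlt; apply/orP; left; apply/eqP; field; rewrite s_neq0 r_neq0.
Qed.

Lemma tensor_form_scale8 F : tensor_form (fun x y => 8 * h x y) (eval_words F) (eval_words F) =
  qsum (word_kernel (fun n => 8 ^+ n * fact_weight C n) h) F.
Proof.
rewrite tensor_form_qsum; last by apply: hermitian_formZ => //; exact: ler0n.
by apply: eq_qsum => u v; rewrite word_kernel_scale_form.
Qed.

Lemma qsum_iter_shift_le t F s :
    fnorm (tensor_form (fun x y => 8 * h x y)) (eval_words F) <= s ->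
  qsum (word_kernel (iter t (@shift_weight C) (@prod_weight C)) h) F <=
  (2 * t`!%:R / 4 ^+ t) * s ^+ 2.
Proof.
move=> Fs.
apply: le_trans (qsum_word_kernel_le_weight F h_pos (iter_prod_weight_le C t)) _.
rewrite (eq_qsum _ (word_kernelZ (fun=> 2 * t`!%:R / 4 ^+ t) _ _)) qsumZ -tensor_form_scale8.
have h8 : hermitian_form (fun x y => 8 * h x y).
  by apply: hermitian_formZ => //; exact: ler0n.
rewrite ler_wpM2l ?divr_ge0 ?mulr_ge0 ?exprn_ge0 ?ler0n//.
rewrite -fnorm_sqr ler_pXn2r// nnegrE ?(fnorm_ge0 (tensor_form_hermitian h8))//.
exact: le_trans (fnorm_ge0 (tensor_form_hermitian h8) _) Fs.
Qed.

Lemma star_term_le (X Y : tensor V) s r t : 0 < s -> 0 < r ->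
    fnorm (tensor_form (fun x y => 8 * h x y)) X <= s ->
    fnorm (tensor_form (fun x y => 8 * h x y)) Y <= r ->
  fnorm (tensor_form h) (star_term Lam X Y t) <= (2 / 4 ^+ t) * s * r.
Proof.
move=> s0 r0; have [F ->] := tensor_formal_rev X; have [G ->] := tensor_formal Y.
move=> Fs Gr; rewrite /star_term (fnormZ tensor_pos).
have t0 : t`!%:R != 0 :> C by rewrite pnatr_eq0 -lt0n fact_gt0.
have -> : 2 / 4 ^+ t * s * r = t`!%:R^-1 * ((2 * t`!%:R / 4 ^+ t) * s * r) :> C.
  by field; rewrite t0 expf_neq0// pnatr_eq0.
rewrite ger0_norm ?invr_ge0 ?ler0n// ler_wpM2l ?invr_ge0 ?ler0n//.
apply: le_trans (fnorm_Sym h_pos _) _; apply: otensor_bounded_fnorm => //.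
apply: (iter_P_op_bounded h_pos Lam_bilin Lam_le); first exact: prod_weight_ge0.
exists [:: (F, G)]; rewrite !big_seq1; split=> //; last exact: qsum_iter_shift_le.
rewrite -(qsum_rev _ F); exact: qsum_iter_shift_le.
Qed.

(** The term of order t is bounded by (2 / 4^t) s r: the 1 / t! of the star product
cancels the t! from the contractions. The sum of these is at most 4 s r. *)
Lemma star_le (X Y : symtensor V) s r : 0 < s -> 0 < r ->
    fnorm (tensor_form (fun x y => 8 * h x y)) (symtensor_val X) <= s ->
    fnorm (tensor_form (fun x y => 8 * h x y)) (symtensor_val Y) <= r ->
  fnorm (tensor_form h) (symtensor_val (star Lam X Y)) <= 4 * s * r.
Proof.
move=> s0 r0 Xs Yr; have [N /(_ N (leqnn N)) ->] := star_finite Lam_bilin X Y.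
apply: le_trans (fnorm_sum tensor_pos _ _ _) _.
apply: (@le_trans _ _ (\sum_(t < N) (2 / 4 ^+ t) * s * r)).
  by apply: ler_sum => t _; exact: star_term_le.
by rewrite -!mulr_suml !ler_pM2r// sum_geometric_le.
Qed.

End StarBound.

(** * Biadditivity of the star product *)

Section StarAdditive.
Variables (K : fieldType) (V : lmodType K) (Lam : V -> V -> K).
Hypothesis Lam_bilin : bilinear_for *%R *%R Lam.

Lemma star_termDl (X X' Y : tensor V) t :
  star_term Lam (X + X') Y t = star_term Lam X Y t + star_term Lam X' Y t.
Proof.
rewrite /star_term (linD (otens_linear_l Y)) (linD (iter_P_op_linear Lam_bilin t)).
by rewrite (linD (@olift_tmul_linear _ V)) (linD (@Sym_is_linear _ V)) scalerDr.
Qed.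

Lemma star_termDr (X Y Y' : tensor V) t :
  star_term Lam X (Y + Y') t = star_term Lam X Y t + star_term Lam X Y' t.
Proof.
rewrite /star_term (linD (otens_linear_r X)) (linD (iter_P_op_linear Lam_bilin t)).
by rewrite (linD (@olift_tmul_linear _ V)) (linD (@Sym_is_linear _ V)) scalerDr.
Qed.

Lemma starDl (X X' Y : symtensor V) :
  star Lam (X + X') Y = star Lam X Y + star Lam X' Y.
Proof.
have [N1 E1] := star_finite Lam_bilin (X + X') Y.
have [N2 E2] := star_finite Lam_bilin X Y.
have [N3 E3] := star_finite Lam_bilin X' Y.
pose N := maxn N1 (maxn N2 N3); apply: val_inj.
have /and3P[l1 l2 l3] : [&& N1 <= N, N2 <= N & N3 <= N]%N.
  by rewrite /N !leq_max !leqnn !orbT.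
rewrite [LHS](E1 N l1) [RHS]/= -[RHS]/(symtensor_val _ + symtensor_val _).
by rewrite (E2 N l2) (E3 N l3) -big_split; apply: eq_bigr => t _; rewrite star_termDl.
Qed.

Lemma starDr (X Y Y' : symtensor V) :
  star Lam X (Y + Y') = star Lam X Y + star Lam X Y'.
Proof.
have [N1 E1] := star_finite Lam_bilin X (Y + Y').
have [N2 E2] := star_finite Lam_bilin X Y.
have [N3 E3] := star_finite Lam_bilin X Y'.
pose N := maxn N1 (maxn N2 N3); apply: val_inj.
have /and3P[l1 l2 l3] : [&& N1 <= N, N2 <= N & N3 <= N]%N.
  by rewrite /N !leq_max !leqnn !orbT.
rewrite [LHS](E1 N l1) [RHS]/= -[RHS]/(symtensor_val _ + symtensor_val _).
by rewrite (E2 N l2) (E3 N l3) -big_split; apply: eq_bigr => t _; rewrite star_termDr.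
Qed.

End StarAdditive.

(** * The scalar part of the star product *)

Section ScalarPart.
Variables (C : numClosedFieldType) (V : lmodType C).

Lemma tscalar_linear : linear (@tscalar _ V : tensor V -> C^o).
Proof.
apply: (tlift_semilinear (th := idfun)) => u a x y v.
by case: u => [|? ?]; rewrite /= scaler0 addr0.
Qed.

Lemma tscalar_Sym (X : tensor V) : tscalar (Sym X) = tscalar X.
Proof.
have [F ->] := tensor_formal X; rewrite (lin_eval_words _ (@Sym_is_linear _ V)).
rewrite (lin_sum tscalar_linear) (lin_eval_words _ tscalar_linear).
apply: eq_bigr => p _; rewrite (linZ tscalar_linear); congr (_ *: _).
rewrite Sym_tens (linZ tscalar_linear) (lin_sum tscalar_linear).
rewrite (eq_bigr (fun=> (p.2 == [::])%:R)) => [|s _]; last first.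
  by rewrite tscalar_tens -!size_eq0 size_map size_enum_ord.
rewrite sumr_const card_Sn tscalar_tens /GRing.scale /= -[X in _ * X]mulr_natl.
by rewrite mulKf// pnatr_eq0 -lt0n fact_gt0.
Qed.

Variables (Lam : V -> V -> C).
Hypothesis Lam_bilin : bilinear_for *%R *%R Lam.

(** A scalar is left only if the t contractions exhaust both words; the factors
k l accumulated on the way give t!^2, one t! of which is in fact_weight. *)
Lemma tscalar_iter_P_op t u w :
  tscalar (olift (@tmul _ V) (iter t (P_op Lam) (otens (tens (rev u)) (tens w)))) =
  (size u == t)%:R * t`!%:R * word_kernel (fact_weight C) Lam u w.
Proof.
have TZ a Z : tscalar (olift (@tmul _ V) (a *: Z)) =
    a * tscalar (olift (@tmul _ V) Z).
  by rewrite (linZ (@olift_tmul_linear _ V)) (linZ tscalar_linear).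
elim: t u w => [|t IHt] u w.
  rewrite /= olift_otens; [|exact: tmul_linear_l|exact: tmul_linear_r].
  rewrite tmul_tens tscalar_tens -size_eq0 size_cat size_rev addn_eq0.
  rewrite mulr1 /word_kernel; case: (u) => [|x u']; last by rewrite /= !mul0r.
  case: w => [|y w] /=; last by rewrite mulr0.
  by rewrite big_nil !mulr1.
rewrite iterSr (P_op_otens Lam_bilin) contract_rev (linZ (iter_P_op_linear Lam_bilin t)).
rewrite TZ IHt; case: u => [|x u]; first by rewrite /= !mul0r.
case: w => [|y w]; first by rewrite /word_kernel /= muln0 !mul0r mulr0.
rewrite word_kernel_cons eqSS /=; have [ut|_] := eqVneq (size u) t; last first.
  by rewrite !mul0r mulr0.
have -> : word_kernel (fun n => fact_weight C n.+1) Lam u w =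
    (size u).+1%:R * word_kernel (fact_weight C) Lam u w.
  rewrite -(word_kernelZ (fun n => n.+1%:R)) /word_kernel /fact_weight.
  by rewrite factS natrM.
have [uw|uw] := eqVneq (size u) (size w); last by rewrite /word_kernel (negbTE uw) !mulr0.
by rewrite -uw -ut factS !natrM; ring.
Qed.

Lemma tscalar_star (X Y : symtensor V) F G :
    symtensor_val X = eval_words_rev F -> symtensor_val Y = eval_words G ->
  tscalar (symtensor_val (star Lam X Y)) =
  \sum_(p <- F) \sum_(q <- G) p.1 * q.1 * word_kernel (fact_weight C) Lam p.2 q.2.
Proof.
move=> XF YG; have [N0 starE] := star_finite Lam_bilin X Y.
have [N1 FN1] := formal_degree F; pose N := maxn N0 N1.
rewrite (starE N) ?leq_maxl// (lin_sum tscalar_linear) XF YG.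
have termE t : tscalar (star_term Lam (eval_words_rev F) (eval_words G) t) =
    \sum_(p <- F) \sum_(q <- G) p.1 * q.1 *
      ((size p.2 == t)%:R * word_kernel (fact_weight C) Lam p.2 q.2).
  rewrite /star_term (linZ tscalar_linear) tscalar_Sym otens_eval_words.
  rewrite (lin_sum (iter_P_op_linear Lam_bilin t)) (lin_sum (@olift_tmul_linear _ V)).
  rewrite (lin_sum tscalar_linear) scaler_sumr; apply: eq_bigr => p _.
  rewrite (lin_sum (iter_P_op_linear Lam_bilin t)) (lin_sum (@olift_tmul_linear _ V)).
  rewrite (lin_sum tscalar_linear) scaler_sumr; apply: eq_bigr => q _.
  rewrite (linZ (iter_P_op_linear Lam_bilin t)) (linZ (@olift_tmul_linear _ V)).
  rewrite (linZ tscalar_linear) tscalar_iter_P_op /GRing.scale /=.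
  by field; rewrite pnatr_eq0 -lt0n fact_gt0.
under eq_bigr do rewrite termE.
rewrite exchange_big; elim: F {XF termE} FN1 => [|p F IHF] FN1; first by rewrite !big_nil.
rewrite !big_cons IHF => [|q qF]; last by apply: FN1; right.
have pN : (size p.2 < N)%N by rewrite leq_max FN1 ?orbT//; left.
congr (_ + _); rewrite exchange_big; apply: eq_bigr => q _ /=.
rewrite (bigD1 (Ordinal pN))//= eqxx mul1r big1 ?addr0// => t tp.
suff /negbTE-> : size p.2 != t by rewrite mul0r mulr0.
by apply: contra_neq tp => pt; exact: val_inj.
Qed.

End ScalarPart.

(** * The involution *)

Section Involution.
Variables (C : numClosedFieldType) (V : lmodType C) (bar : V -> V).
Hypothesis bar_lin : GRing.linear_for (conjC \; *:%R) bar.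
Hypothesis bar_inv : involutive bar.

(** Over R[i] this is convertible to tstar. *)
Definition tensor_star : tensor V -> tensor V :=
  tlift conjC (fun u => tens (rev (map bar u))).

Lemma tensor_star_multilinear : multilinear conjC (fun u => tens (rev (map bar u))).
Proof.
move=> u a x y w; rewrite !map_cat /= !rev_cat !rev_cons !cat_rcons.
by rewrite (bar_lin a x y) tens_multilinear.
Qed.

Definition map_bar (F : seq (C * seq V)) := [seq (p.1^*, map bar p.2) | p <- F].

Lemma tensor_star_eval_words F : tensor_star (eval_words F) = eval_words_rev (map_bar F).
Proof.
have semi := tlift_semilinear (th := conjC) tensor_star_multilinear.
rewrite eval_words_revE big_map; elim: F => [|p F IHF].
  rewrite /eval_words !big_nil; have := semi (- 1) 0 0.
  by rewrite scaleN1r oppr0 addr0 /= rmorphN1 scaleN1r addNr.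
rewrite eval_words_cons big_cons -IHF [LHS](semi p.1 (tens p.2) (eval_words F)) /=.
by rewrite (tlift_tens (th := conjC) _ tensor_star_multilinear).
Qed.

Variable h : V -> V -> C.
Hypothesis h_pos : hermitian_form h.

(** The involution is isometric from the norm of this form to that of h. The
exchange of the arguments restores antilinearity in the first one. *)
Definition conj_form (v w : V) : C := h (bar w) (bar v).

Lemma conj_form_hermitian : hermitian_form conj_form.
Proof.
split=> [|x y|x]; last 2 first.
- exact: (form_conj h_pos (bar y) (bar x)).
- exact: (form_ge0 h_pos (bar x)).
split=> [y a x x'|x a y y']; rewrite /conj_form bar_lin /=.
  by rewrite (formDr h_pos) (formZr h_pos).
by rewrite (formDl h_pos) (formZl h_pos) conjCK.
Qed.

Lemma word_kernel_map_bar w u v :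
  word_kernel w h (map bar u) (map bar v) = word_kernel w conj_form v u.
Proof.
rewrite /word_kernel !size_map eq_sym; case: ifP => [/eqP->|//]; congr (_ * _).
elim: u v => [|x u IHu] [|y v] //=; rewrite ?big_nil// !big_cons IHu.
by [].
Qed.

Lemma tensor_form_tensor_star X :
  tensor_form h (tensor_star X) (tensor_star X) = tensor_form conj_form X X.
Proof.
have [F ->] := tensor_formal X; rewrite tensor_star_eval_words !tensor_form_qsum//.
  rewrite qsum_rev /qsum big_map exchange_big big_map.
  apply: eq_bigr => p _; apply: eq_bigr => q _ /=.
  by rewrite conjCK word_kernel_map_bar; ring.
exact: conj_form_hermitian.
Qed.

(** Since bar is involutive, Lam(bar x, y) = h(x, y): the complete contraction of
the conjugated word with v is the inner product. The hypothesis X' = X^* is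
stated on the underlying tensors, X' being symmetric. *)
Lemma tscalar_star_tensor_star (X Y X' : symtensor V) :
    symtensor_val X' = tensor_star X ->
    bilinear_for *%R *%R (fun v w => h (bar v) w) ->
  tscalar (symtensor_val (star (fun v w => h (bar v) w) X' Y)) = tensor_form h X Y.
Proof.
move=> X'E bil; have [F XF] := tensor_formal X; have [G YG] := tensor_formal Y.
rewrite XF tensor_star_eval_words in X'E.
rewrite (tscalar_star bil X'E YG) XF YG tensor_form_eval_words//.
rewrite big_map; apply: eq_bigr => p _; apply: eq_bigr => q _; congr (_ * _).
rewrite /word_kernel size_map; case: ifP => // _; congr (_ * _).
elim: (p.2) (q.2) => [|x u IHu] [|y v] //=; rewrite ?big_nil// !big_cons IHu/=.
by rewrite bar_inv.
Qed.

End Involution.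

(** The scalar part is the inner product with the empty word, a unit vector. *)
Lemma tscalar_le (C : numClosedFieldType) (V : lmodType C) (h : V -> V -> C)
    (X : tensor V) : hermitian_form h -> `|tscalar X| <= fnorm (tensor_form h) X.
Proof.
move=> h_pos; have [F ->] := tensor_formal X.
have tensor_pos := tensor_form_hermitian h_pos.
have -> : tscalar (eval_words F) = tensor_form h (tens [::]) (eval_words F).
  rewrite (lin_eval_words _ (@tscalar_linear _ V)) /eval_words tensor_form_sumr//.
  apply: eq_bigr => p _; rewrite tensor_formZr// tensor_form_tens// tscalar_tens /GRing.scale /=.
  by rewrite /word_kernel; case: (p.2) => [|x u]//=; rewrite big_nil mulr1.
apply: le_trans (cauchy_schwarz_fnorm tensor_pos _ _) _.
by rewrite {1}/fnorm tensor_form_tens// /word_kernel /= big_nil mulr1 sqrtC1 mul1r.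
Qed.

(** * Topologies given by seminorm balls *)

Section SeminormTopology.
Variables (R : realType) (E : lmodType R[i]) (t : Topological E).
Local Notation C := R[i].
Let Et : topologicalType := Topological.Pack t.

(** Single balls, rather than finite intersections, are required to form a basis of
neighbourhoods: the family P is directed. *)
Definition ball_neighbourhoods (P : set (E -> C)) : Prop :=
  forall (x : Et) (A : set Et), nbhs x A <->
    exists q e, [/\ P q, 0 < e & forall y : E, q (y - (x : E)) < e -> A y].

Lemma seminorm0 (q : E -> C) : seminorm q -> q 0 = 0.
Proof. by case=> _ qZ _; rewrite -(scale0r 0) qZ normr0 mul0r. Qed.

Lemma seminormN (q : E -> C) x : seminorm q -> q (- x) = q x.
Proof. by case=> _ qZ _; rewrite -scaleN1r qZ normrN1 mul1r. Qed.

Variable P : set (E -> C).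
Hypothesis P_seminorm : forall q, P q -> seminorm q.
Hypothesis t_nbhs : ball_neighbourhoods P.

Lemma nbhs_ball_seminorm (x : Et) q e : P q -> 0 < e ->
  nbhs x [set y : Et | q ((y : E) - (x : E)) < e].
Proof. by move=> Pq e0; apply/t_nbhs; exists q, e. Qed.

Lemma seminorm_add_continuous :
  continuous (fun z : Et * Et => (z.1 : E) + (z.2 : E) : Et).
Proof.
move=> [x y] A /t_nbhs[q [e [Pq e0 qA]]]; have [_ _ qD] := P_seminorm Pq.
have e20 : 0 < e / 2 by rewrite divr_gt0.
exists ([set x' : Et | q ((x' : E) - (x : E)) < e / 2],
        [set y' : Et | q ((y' : E) - (y : E)) < e / 2]).
  by split; exact: nbhs_ball_seminorm.
move=> [x' y'] [/= x'x y'y]; apply: qA; rewrite /= opprD addrACA.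
by apply: le_lt_trans (qD _ _) _; rewrite [e]splitr ltrD.
Qed.

Lemma seminorm_scale_continuous :
  continuous (fun z : C^o * Et => (z.1 : C) *: (z.2 : E) : Et).
Proof.
move=> [a x] A /t_nbhs[q [e [Pq e0 qA]]]; have [q0 qZ qD] := P_seminorm Pq.
have e20 : 0 < e / 2 by rewrite divr_gt0.
have a1 : 0 < `|a| + 1 by rewrite ltr_wpDl.
have x1 : 0 < q x + 1 by rewrite ltr_wpDl.
exists ([set a' : C^o | `|a - a'| < 1 /\ `|a - a'| < e / 2 / (q x + 1)],
        [set x' : Et | q ((x' : E) - (x : E)) < e / 2 / (`|a| + 1)]).
  split; last by apply: nbhs_ball_seminorm => //; rewrite divr_gt0.
  apply: filterI; first exact: (@nbhsx_ballx _ (C^o) a 1).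
  by apply: (@nbhsx_ballx _ (C^o) a); rewrite divr_gt0.
move=> [a' x'] [/= [aa' aa'x] x'x]; apply: qA => /=.
have -> : a' *: (x' : E) - a *: (x : E) =
    a' *: ((x' : E) - (x : E)) + (a' - a) *: (x : E).
  by rewrite scalerBr scalerBl addrA subrK.
apply: le_lt_trans (qD _ _) _; rewrite !qZ [e]splitr distrC ltr_leD//.
  apply: (@le_lt_trans _ _ ((`|a| + 1) * q ((x' : E) - (x : E)))).
    rewrite ler_wpM2r// -[a'](subrK a) addrC; apply: le_trans (ler_normD _ _) _.
    by rewrite lerD2l distrC ltW.
  by rewrite mulrC -ltr_pdivlMr.
apply: (@le_trans _ _ (`|a - a'| * (q x + 1))).
  by rewrite ler_wpM2l// lerDl.
by rewrite -ler_pdivlMr// ltW.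
Qed.

Lemma seminorm_ball_open q (x : Et) e : P q ->
  open ([set y | q ((y : E) - (x : E)) < e] : set Et).
Proof.
move=> Pq; have [_ _ qD] := P_seminorm Pq; rewrite openE => y /= yx.
apply/t_nbhs; exists q, (e - q ((y : E) - (x : E))).
split=> //; first by rewrite subr_gt0.
move=> z zy; rewrite /= -[z](subrK (y : E)) -addrA.
by apply: le_lt_trans (qD _ _) _; rewrite -ltrBrDr.
Qed.

Lemma seminorm_ball_convex q (x : E) e : P q ->
  convex_set ([set y | q (y - x) < e] : set E).
Proof.
move=> Pq; have [q0 qZ qD] := P_seminorm Pq.
apply/convex_setW => y z; rewrite !inE /= => yx zx l l0 l1; rewrite inE /=.
have -> : conv l (y : convex_lmodType E) (z : convex_lmodType E) - x =
    l%:num *: (y - x) + (1 - l%:num) *: (z - x).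
  rewrite !scalerBr addrACA -opprD -scalerDl [l%:num + _]addrC subrK scale1r.
  by [].
apply: le_lt_trans (qD _ _) _; rewrite !qZ !ger0_norm ?subr_ge0 ?ltW//.
have -> : e = l%:num * e + (1 - l%:num) * e.
  by rewrite -mulrDl addrC subrK mul1r.
by rewrite ltrD// ltr_pM2l// subr_gt0.
Qed.

Lemma seminorm_locally_convex : locally_convex_topology t.
Proof.
split; [exact: seminorm_add_continuous|exact: seminorm_scale_continuous|].
exists [set B | exists q (x : E) e, P q /\ B = [set y : Et | q ((y : E) - x) < e]].
  move=> b; rewrite inE => -[q [x [e [Pq ->]]]].
  exact: seminorm_ball_convex.
split=> [B [q [x [e [Pq ->]]]]|x A]; first exact: seminorm_ball_open.
move=> /t_nbhs[q [e [Pq e0 qA]]].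
exists [set y : Et | q ((y : E) - (x : E)) < e] => //; split.
  by exists q, x, e.
by rewrite /= subrr seminorm0//; exact: P_seminorm.
Qed.

End SeminormTopology.

(** * Continuous bilinear forms *)

Section SupremumSeminorm.
Variables (R : realType) (E : lmodType R[i]) (T : Type).
Local Notation C := R[i].

(** The supremum is taken over the reals, with 0 adjoined so that it also exists
when W is empty. *)
Lemma supremum_seminorm (W : set T) (l : T -> E -> C) :
    (forall w, linear (l w : E -> C^o)) ->
    (forall v, exists M, forall w, W w -> `|l w v| <= M) ->
  exists p : E -> C, [/\ seminorm p,
    forall v w, W w -> `|l w v| <= p v
    & forall v M, 0 <= M -> (forall w, W w -> `|l w v| <= M) -> p v <= M].
Proof.
move=> l_lin l_bnd.
have normE (z : C) : exists r : R, `|z| = r%:C%C.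
  by rewrite normc_def; eexists.
have geE (M : C) : 0 <= M -> exists2 r : R, 0 <= r & M = r%:C%C.
  move=> M0; have /complex_realP[r Mr] := ger0_real M0; exists r => //.
  by rewrite -lecR -Mr.
pose S v := [set r : R | r = 0 \/ exists2 w, W w & `|l w v| = r%:C%C].
pose p v : C := (sup (S v))%:C%C.
have S0 v : S v 0 by left.
have Sub v : has_ubound (S v).
  have [M lM] := l_bnd v.
  have [r r0 rE] := geE `|M| (normr_ge0 M).
  exists r => s [->//|[w Ww sE]].
  rewrite -lecR -rE -sE; apply: le_trans (lM w Ww) _.
  have Mr : M \is Num.real.
    by apply: ger0_real; apply: le_trans (lM w Ww).
  exact: real_ler_norm.
have p_ub v w : W w -> `|l w v| <= p v.
  move=> Ww; have [r rE] := normE (l w v); rewrite rE lecR.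
  by apply: ub_le_sup => //; right; exists w.
have p_lub v M : 0 <= M -> (forall w, W w -> `|l w v| <= M) -> p v <= M.
  move=> M0 lM; have [r r0 rE] := geE M M0; rewrite rE lecR; apply: ge_sup.
    by exists 0.
  by move=> s [->//|[w Ww sE]]; rewrite -lecR -sE -rE lM.
have p0 v : 0 <= p v by rewrite lecR; apply: ub_le_sup.
have lD w x y : l w (x + y) = l w x + l w y by exact: linD (l_lin w) _ _.
have lZ w a x : l w (a *: x) = a * l w x by exact: linZ (l_lin w) _ _.
have pZ_le a v : p (a *: v) <= `|a| * p v.
  apply: p_lub => [|w Ww]; first by rewrite mulr_ge0.
  by rewrite lZ normrM ler_wpM2l// p_ub.
exists p; split=> //; split=> // [a v|v w].
  apply/eqP; rewrite eq_le pZ_le /=.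
  have [->|a0] := eqVneq a 0; first by rewrite normr0 mul0r p0.
  rewrite -[v in leLHS](scalerK a0) -ler_pdivlMl ?normr_gt0//.
  by rewrite -normfV; exact: pZ_le.
apply: p_lub => [|u Wu]; first exact: addr_ge0.
by rewrite lD; apply: le_trans (ler_normD _ _) _; rewrite lerD// p_ub.
Qed.

End SupremumSeminorm.

Section BoundedForms.
Variables (R : realType) (V : tvsType R[i]).
Local Notation C := R[i].

Lemma absorbing (U : set V) (v : V) : nbhs 0 U ->
  exists2 d : C, 0 < d & U (d *: v).
Proof.
move=> U0; have := @scale_continuous C V (0, v) U.
rewrite /= scale0r => /(_ U0)[[A B] [/= A0 Bv] AB].
have [/= e e0 eA] := (nbhs_ballP (0 : C^o) A).1 A0.
have e20 : 0 < e / 2 by rewrite divr_gt0.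
exists (e / 2) => //; apply: (AB (e / 2, v)); split => /=.
  apply: eA; rewrite -ball_normE /= sub0r normrN gtr0_norm//.
  by rewrite ltr_pdivrMr ?ltr0n// mulr_natr mulr2n ltrDl.
exact: nbhs_singleton.
Qed.

Lemma seminorm_continuous (p : V -> C) (U : set V) : seminorm p ->
  nbhs 0 U -> (forall v, U v -> p v <= 1) -> continuous (p : V -> C^o).
Proof.
move=> sp U0 pU x; have [p0 pZ pD] := sp.
apply/cvgrPdist_lt => e e0; have e20 : 0 < e / 2 by rewrite divr_gt0.
have e2_neq0 : e / 2 != 0 by rewrite gt_eqF.
have := nbhsT x (nbhs0Z e2_neq0 U0); apply: filterS => _ [_ [u Uu <-] <-].
have small a b : p a - p b <= p (a - b).
  by rewrite lerBlDr -[a in leLHS](subrK b).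
apply: (@le_lt_trans _ _ (e / 2)); last first.
  by rewrite ltr_pdivrMr ?ltr0n// mulr_natr mulr2n ltrDl.
have pu : p (e / 2 *: u) <= e / 2.
  by rewrite pZ gtr0_norm// ger_pMr// pU.
rewrite real_ler_norml ?realB ?ger0_real//; apply/andP; split.
  rewrite lerNl opprB; apply: le_trans (small _ _) _.
  by rewrite addrAC subrr add0r.
apply: le_trans (small _ _) _; rewrite opprD addrA subrr add0r.
by rewrite seminormN.
Qed.

(** Let U be a neighbourhood of 0 with |Lam| <= 1 on U x U. Take for p(v) the
supremum of |Lam(v, w)| over w in U, and for q(w) the supremum of |Lam(v, w)|
over p(v) <= 1; both are at most 1 on U, hence continuous, and homogeneity gives
the product bound. *)
Lemma continuous_bilinear_bounded (Lam : V -> V -> C) :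
    bilinear_for *%R *%R Lam -> continuous_form Lam ->
  exists p q : V -> C, [/\ seminorm p, continuous (p : V -> C^o),
    seminorm q, continuous (q : V -> C^o)
    & forall v w, `|Lam v w| <= p v * q w].
Proof.
move=> [Lam_l Lam_r] Lam_cont.
have L0 (v : V) : Lam 0 v = 0 := lin0 (Lam_l v : linear (Lam^~ v : V -> C^o)).
have LZl (a : C) (v w : V) : Lam (a *: v) w = a * Lam v w :=
  linZ (Lam_l w : linear (Lam^~ w : V -> C^o)) a v.
have LZr (a : C) (v w : V) : Lam v (a *: w) = a * Lam v w :=
  linZ (Lam_r v : linear (Lam v : V -> C^o)) a w.
have [U U0 LamU] : exists2 U : set V, nbhs 0 U &
    forall v w, U v -> U w -> `|Lam v w| <= 1.
  have := Lam_cont (0, 0) (ball (0 : C^o) 1); rewrite /= L0.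
  move=> /(_ (nbhsx_ballx _ _ ltr01))[[A B] [/= A0 B0] AB].
  exists (A `&` B); first exact: filterI.
  move=> v w [Av _] [_ Bw]; have := AB (v, w) (conj Av Bw).
  by rewrite /= -ball_normE /= sub0r normrN => /ltW.
have [v|p [sp p_ub p_lub]] :=
    @supremum_seminorm R V V U (fun w v => Lam v w) Lam_l.
  have [d d0 Uv] := absorbing v U0; exists d^-1 => w Uw.
  rewrite -[leLHS](mulKf (lt0r_neq0 d0)) -{2}(gtr0_norm d0) -normrM -LZl.
  by apply: ler_piMr; [rewrite invr_ge0 ltW|exact: LamU].
have [p0 pZ _] := sp.
have [w|q [sq q_ub q_lub]] :=
    @supremum_seminorm R V V [set v | p v <= 1] Lam Lam_r.
  have [d d0 Uw] := absorbing w U0; exists d^-1 => v /= pv.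
  rewrite -[leLHS](mulKf (lt0r_neq0 d0)) -{2}(gtr0_norm d0) -normrM.
  rewrite -LZr; apply: ler_piMr; first by rewrite invr_ge0 ltW.
  by rewrite (le_trans _ pv)// p_ub.
have [q0 _ _] := sq.
exists p, q; split=> //.
- apply: (seminorm_continuous sp U0) => v Uv.
  by apply: p_lub => // w Uw; exact: LamU.
- apply: (seminorm_continuous sq U0) => w Uw.
  by apply: q_lub => // v /= pv; rewrite (le_trans _ pv)// p_ub.
move=> v w; have [pv0|pv0] := eqVneq (p v) 0; last first.
  have pv : 0 < p v by rewrite lt_def pv0 p0.
  rewrite -ler_pdivrMl// -[(p v)^-1]gtr0_norm ?invr_gt0// -normrM -LZl.
  by apply: q_ub; rewrite /= pZ gtr0_norm ?invr_gt0// mulVf.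
(* If p(v) = 0, all multiples of v lie in the set defining q, which forces
   Lam(v, w) = 0; otherwise the multiple below would exceed q(w). *)
rewrite pv0 mul0r normr_le0; apply: contraT => L_neq0.
have n0 : 0 < `|Lam v w| by rewrite normr_gt0.
have c0 : 0 < (q w + 1) / `|Lam v w| by rewrite divr_gt0// ltr_wpDl.
have := q_ub w ((q w + 1) / `|Lam v w| *: v).
rewrite /= pZ pv0 mulr0 => /(_ ler01); rewrite LZl normrM gtr0_norm//.
by rewrite divfK ?gt_eqF// gerDl ler10.
Qed.

Lemma continuous_hilbert_formD h b : continuous_hilbert_form h ->
  continuous_hilbert_form b ->
  continuous_hilbert_form (fun x y : V => h x y + b x y).
Proof.
move=> [h_pos h_cont] [b_pos b_cont]; split.
  exact: hermitian_formD.
by move=> z; apply: cvgD; [exact: h_cont|exact: b_cont].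
Qed.

Lemma continuous_hilbert_formZ (c : C) h : 0 <= c -> continuous_hilbert_form h ->
  continuous_hilbert_form (fun x y : V => c * h x y).
Proof.
move=> c0 [h_pos h_cont]; split; first exact: hermitian_formZ.
move=> z; apply: (@cvgM _ _ (nbhs z) _ (fun=> c) (fun z : V * V => h z.1 z.2)).
  exact: cvg_cst.
exact: h_cont.
Qed.

(** The sum of two Hilbert forms that dominate the seminorms p and q dominates
both. *)
Lemma continuous_bilinear_hilbert (Lam : V -> V -> C) : hilbert_cofinal V ->
    bilinear_for *%R *%R Lam -> continuous_form Lam ->
  exists2 b, continuous_hilbert_form b &
    forall v w, `|Lam v w| ^+ 2 <= b v v * b w w.
Proof.
move=> V_cofinal Lam_bil Lam_cont.
have [p [q [sp pc sq qc Lam_le]]] := continuous_bilinear_bounded Lam_bil Lam_cont.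
have [h1 h1_hilb ph1] := V_cofinal p sp pc.
have [h2 h2_hilb qh2] := V_cofinal q sq qc.
exists (fun x y => h1 x y + h2 x y); first exact: continuous_hilbert_formD.
move=> v w; have h1_pos : hermitian_form h1 := h1_hilb.1.
have h2_pos : hermitian_form h2 := h2_hilb.1.
have [p0 _ _] := sp; have [q0 _ _] := sq.
apply: (@le_trans _ _ ((p v * q w) ^+ 2)).
  by rewrite ler_pXn2r ?nnegrE ?mulr_ge0.
rewrite exprMn ler_pM ?exprn_ge0//.
  apply: (@le_trans _ _ (h1 v v)); last by rewrite lerDl (form_ge0 h2_pos).
  by rewrite -(fnorm_sqr h1) ler_pXn2r ?nnegrE ?(fnorm_ge0 h1_pos)//; exact: ph1.
apply: (@le_trans _ _ (h2 w w)); last by rewrite lerDr (form_ge0 h1_pos).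
by rewrite -(fnorm_sqr h2) ler_pXn2r ?nnegrE ?(fnorm_ge0 h2_pos)//; exact: qh2.
Qed.

End BoundedForms.

Lemma tensor_form_symtensor_hermitian (C : numClosedFieldType) (V : lmodType C)
    (h : V -> V -> C) : hermitian_form h ->
  hermitian_form (fun X Y : symtensor V => tensor_form h (symtensor_val X) (symtensor_val Y)).
Proof.
move=> /tensor_form_hermitian[[gl gr] gc g0].
split; [split=> [Y a X X'|X a Y Y']|move=> X Y|move=> X].
- exact: gl.
- exact: gr.
- exact: gc.
- exact: g0.
Qed.

(** * Tensor seminorms over the complex numbers *)

Section Seminorms.
Variables (R : realType).
Local Notation C := R[i].

Lemma seminorm_fnorm (E : lmodType C) (f : E -> E -> C) :
  hermitian_form f -> seminorm (fnorm f).
Proof.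
by move=> f_pos; split; [exact: fnorm_ge0|exact: fnormZ|exact: fnormD].
Qed.

Lemma tnormE (V : lmodType C) (h : V -> V -> C) (X : tensor V) :
  tnorm h X = fnorm (tensor_form h) X.
Proof. by []. Qed.

Lemma seminorm_tnorm (V : lmodType C) (h : V -> V -> C) :
  positive_hermitian h -> seminorm (fun X : symtensor V => tnorm h X).
Proof.
move=> h_pos.
exact: (seminorm_fnorm (E := symtensor V) (tensor_form_symtensor_hermitian h_pos)).
Qed.

Lemma seminorm_tnorm_tensor (V : lmodType C) (h : V -> V -> C) :
  positive_hermitian h -> seminorm (fun X : tensor V => tnorm h X).
Proof.
by move=> h_pos; exact: (seminorm_fnorm (E := tensor V) (tensor_form_hermitian h_pos)).
Qed.

Lemma tnorm_ge0 (V : lmodType C) (h : V -> V -> C) (X : tensor V) :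
  positive_hermitian h -> 0 <= tnorm h X.
Proof. by move=> /seminorm_tnorm_tensor[+ _ _]; apply. Qed.

Lemma tnorm0 (V : lmodType C) (h : V -> V -> C) :
  positive_hermitian h -> tnorm h 0 = 0.
Proof. by move=> /seminorm_tnorm_tensor/seminorm0. Qed.

Lemma tnormD (V : lmodType C) (h : V -> V -> C) (X Y : tensor V) :
  positive_hermitian h -> tnorm h (X + Y) <= tnorm h X + tnorm h Y.
Proof. by move=> /seminorm_tnorm_tensor[_ _ +]; apply. Qed.

Lemma tnorm_mono (V : lmodType C) (h b : V -> V -> C) (X : tensor V) :
    positive_hermitian h -> positive_hermitian b ->
  tnorm h X <= tnorm (fun x y => h x y + b x y) X.
Proof.
move=> h_pos b_pos; have hb_pos := hermitian_formD h_pos b_pos.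
rewrite !tnormE /fnorm ler_sqrtC ?nnegrE.
- exact: tensor_form_mono.
- exact: (form_ge0 (tensor_form_hermitian h_pos)).
- exact: (form_ge0 (tensor_form_hermitian hb_pos)).
Qed.

Lemma tnorm_mono_r (V : lmodType C) (h b : V -> V -> C) (X : tensor V) :
    positive_hermitian h -> positive_hermitian b ->
  tnorm b X <= tnorm (fun x y => h x y + b x y) X.
Proof.
move=> h_pos b_pos; have := tnorm_mono X b_pos h_pos; congr (_ <= tnorm _ X).
by apply/funext => x; apply/funext => y; rewrite addrC.
Qed.

Lemma positive_lower_bound (a b : C) : 0 < a -> 0 < b ->
  exists e : C, [/\ 0 < e, e <= a & e <= b].
Proof.
move=> a0 b0; have ab0 : 0 < a + b by rewrite addr_gt0.
exists (a * b / (a + b)); split; first by rewrite divr_gt0// mulr_gt0.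
  by rewrite ler_pdivrMr// ler_pM2l// lerDr ltW.
by rewrite ler_pdivrMr// mulrC ler_pM2l// lerDl ltW.
Qed.

End Seminorms.

(** * Neighbourhoods of symmetric tensors *)

Section SymmetricTensorTopology.
Variables (R : realType) (V : tvsType R[i]).
Local Notation C := R[i].

Lemma zero_hilbert_form : continuous_hilbert_form (fun _ _ : V => 0 : C).
Proof.
split; last by move=> z; exact: cvg_cst.
split=> [|v w|v]; rewrite ?rmorph0//.
by split=> [w a x y|w a x y] /=; rewrite mulr0 addr0.
Qed.

Definition hilbert_seminorms : set (symtensor V -> C) :=
  [set q | exists2 h, continuous_hilbert_form h & q = (fun X : symtensor V => tnorm h X)].

Lemma hilbert_seminorms_seminorm q : hilbert_seminorms q -> seminorm q.
Proof. by move=> [h [h_pos _] ->]; exact: seminorm_tnorm. Qed.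

Lemma subbase_open (B : set (tensor V)) : tensor_subbase B -> open B.
Proof.
move=> sB; exists [set B]; last by rewrite bigcup_set1.
by move=> _ ->; exact: (@finI_from1 _ _ (@tensor_subbase R V) id).
Qed.

(** Finitely many subbasic sets around X contain a ball of the sum of their forms,
by monotonicity of the norms in h. *)
Lemma subbase_ball (X : tensor V) (s : seq (set (tensor V))) :
    (forall B, B \in s -> tensor_subbase B /\ B X) ->
  exists h e, [/\ continuous_hilbert_form h, 0 < e &
    forall Y, tnorm h (Y - X) < e -> forall B, B \in s -> B Y].
Proof.
elim: s => [|B s IHs] sX.
  by exists (fun _ _ => 0), 1; split=> //; exact: zero_hilbert_form.
have [|h1 [e1 [h1_hilb e10 h1s]]] := IHs.
  by move=> B' B's; apply: sX; rewrite inE B's orbT.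
have [|[h0 [X0 [e0 [h0_hilb e00 BE]]]] BX] := sX B; first by rewrite inE eqxx.
have r0 : 0 < e0 - tnorm h0 (X - X0) by rewrite subr_gt0; move: BX; rewrite BE.
have [e [e_gt0 ee1 eer]] := positive_lower_bound e10 r0.
exists (fun x y => h0 x y + h1 x y), e; split; [|exact: e_gt0|].
  exact: continuous_hilbert_formD.
move=> Y Ye B'; rewrite inE => /predU1P[->|B's]; last first.
  apply: (h1s _ _ _ B's); apply: lt_le_trans ee1; apply: le_lt_trans Ye.
  exact: (tnorm_mono_r _ h0_hilb.1 h1_hilb.1).
rewrite BE /=; have -> : Y - X0 = (Y - X) + (X - X0) by rewrite addrA subrK.
apply: le_lt_trans (tnormD _ _ h0_hilb.1) _; rewrite -ltrBrDr.
apply: lt_le_trans eer; apply: le_lt_trans Ye.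
exact: (tnorm_mono _ h0_hilb.1 h1_hilb.1).
Qed.

Lemma open_tensor_ball (B : set (tensor V)) X : open B -> B X ->
  exists h e, [/\ continuous_hilbert_form h, 0 < e &
    forall Y, tnorm h (Y - X) < e -> B Y].
Proof.
move=> [D Dsub <-] [U DU UX]; have [F Fsub UE] := Dsub _ DU.
have [|h [e [h_hilb e0 hF]]] := @subbase_ball X (enum_fset F).
  move=> B' B'F; split; first by have := Fsub _ B'F; rewrite inE.
  by move: UX; rewrite -UE; exact.
exists h, e; split=> // Y Ye; exists U; first exact: DU.
have UY : U Y by rewrite -UE => B' /= B'F; exact: hF.
exact: UY.
Qed.

Lemma symtensor_ball_neighbourhoods :
  ball_neighbourhoods (symtensor_topology V) hilbert_seminorms.
Proof.
move=> X A; split.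
  move=> [_ [[B B_open <-] BX BA]].
  have [h [e [h_hilb e0 hB]]] := open_tensor_ball B_open BX.
  exists (fun Y : symtensor V => tnorm h Y), e; split; [by exists h|exact: e0|].
  by move=> Y Ye; apply: BA; exact: hB.
move=> [_ [e [[h h_hilb ->] e0 hA]]].
exists (@symtensor_val _ V @^-1` [set Y | tnorm h (Y - symtensor_val X) < e]).
split.
- exists [set Y | tnorm h (Y - symtensor_val X) < e] => //.
  by apply: subbase_open; exists h, (symtensor_val X), e.
- by rewrite /= subrr tnorm0//; exact: h_hilb.1.
- by move=> Y; exact: hA.
Qed.

Lemma symtensor_locally_convex : locally_convex_topology (symtensor_topology V).
Proof.
exact: seminorm_locally_convex hilbert_seminorms_seminorm
  symtensor_ball_neighbourhoods.
Qed.

End SymmetricTensorTopology.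

(** * Continuity of the star products *)

Section StarContinuity.
Variables (R : realType) (V : tvsType R[i]).
Local Notation C := R[i].

(** A biadditive map with the bound of star_le is continuous at (X, Y) by expanding
around (X, Y). *)
Lemma star_continuous (Lam : V -> V -> C) : hilbert_cofinal V ->
    bilinear_for *%R *%R Lam -> continuous_form Lam ->
  let St : topologicalType := Topological.Pack (symtensor_topology V) in
  continuous (fun z : St * St => star Lam z.1 z.2 : St).
Proof.
move=> V_cofinal Lam_bil Lam_cont St [X Y] A.
move=> /symtensor_ball_neighbourhoods[_ [e [[h [h_pos h_cont] ->] e0 hA]]].
have [b [b_pos b_cont] Lam_b] :=
  continuous_bilinear_hilbert V_cofinal Lam_bil Lam_cont.
pose hb (x y : V) := h x y + b x y.
have hb_pos : hermitian_form hb := hermitian_formD h_pos b_pos.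
have b_le_hb v : b v v <= hb v v by rewrite lerDr (form_ge0 h_pos).
have Lam_hb v w : `|Lam v w| ^+ 2 <= hb v v * hb w w.
  apply: le_trans (Lam_b v w) _.
  by apply: ler_pM => //; exact: (form_ge0 b_pos).
pose h8 (x y : V) := 8 * hb x y.
have h8_pos : hermitian_form h8 by apply: hermitian_formZ => //; exact: ler0n.
have h8_hilb : continuous_hilbert_form h8.
  by apply: continuous_hilbert_formZ; [exact: ler0n|exact: continuous_hilbert_formD].
have bound (X1 Y1 : symtensor V) s r : 0 < s -> 0 < r ->
    tnorm h8 X1 <= s -> tnorm h8 Y1 <= r -> tnorm h (star Lam X1 Y1) <= 4 * s * r.
  move=> s0 r0 X1s Y1r; apply: le_trans (tnorm_mono _ h_pos b_pos) _.
  exact: (star_le hb_pos Lam_bil Lam_hb s0 r0 X1s Y1r).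
pose a := tnorm h8 X + 1; pose c := tnorm h8 Y + 1.
have a0 : 0 < a by rewrite ltr_wpDl// tnorm_ge0.
have c0 : 0 < c by rewrite ltr_wpDl// tnorm_ge0.
have ac0 : 0 < a + c + 1 by rewrite addr_gt0// addr_gt0.
have m0 : 0 < 4 * (a + c + 1) by rewrite mulr_gt0// ltr0n.
(* The three terms of the expansion are at most 4 d d, 4 d c and 4 a d, and
   d <= 1; the summand e in the denominator ensures d <= 1 and the strict bound. *)
pose d := e / (4 * (a + c + 1) + e).
have me0 : 0 < 4 * (a + c + 1) + e by rewrite addr_gt0.
have d0 : 0 < d by rewrite divr_gt0.
have d1 : d <= 1 by rewrite ler_pdivrMr// mul1r lerDr ltW.
have de : d * (4 * (a + c + 1)) < e.
  by rewrite mulrAC ltr_pdivrMr// ltr_pM2l// ltrDl.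
have ball_nbhs (Z : symtensor V) :
    nbhs (Z : St) [set Z' : St | tnorm h8 ((Z' : symtensor V) - Z) < d].
  by apply/symtensor_ball_neighbourhoods;
    exists (fun Z' : symtensor V => tnorm h8 Z'), d; split=> //; exists h8.
exists ([set X' : St | tnorm h8 ((X' : symtensor V) - X) < d],
        [set Y' : St | tnorm h8 ((Y' : symtensor V) - Y) < d]); first by split; exact: ball_nbhs.
move=> [X' Y'] [/= X'X Y'Y].
pose dX : symtensor V := X' - X; pose dY : symtensor V := Y' - Y.
have E : star Lam X' Y' - star Lam X Y =
    star Lam dX dY + star Lam dX Y + star Lam X dY :> symtensor V.
  have X'E : X' = dX + X :> symtensor V by rewrite subrK.
  have Y'E : Y' = dY + Y :> symtensor V by rewrite subrK.
  by rewrite X'E Y'E starDl// !starDr// addrA addrK.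
suff H : tnorm h (symtensor_val (star Lam dX dY + star Lam dX Y + star Lam X dY)) < e.
  by rewrite -E in H; apply: hA; exact: H.
have [_ _ qD] := seminorm_tnorm h_pos.
apply: le_lt_trans de; apply: le_trans (qD _ _) _.
apply: le_trans (lerD (qD _ _) (lexx _)) _.
have Xa : tnorm h8 X <= a by rewrite lerDl.
have Yc : tnorm h8 Y <= c by rewrite lerDl.
have dXd : tnorm h8 dX <= d by exact: ltW.
have dYd : tnorm h8 dY <= d by exact: ltW.
have b1 := bound _ _ _ _ d0 d0 dXd dYd.
have b2 := bound _ _ _ _ d0 c0 dXd Yc.
have b3 := bound _ _ _ _ a0 d0 Xa dYd.
apply: le_trans (lerD (lerD b1 b2) b3) _.
have -> : d * (4 * (a + c + 1)) = 4 * d * 1 + 4 * d * c + 4 * a * d by ring.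
by rewrite !lerD2r ler_wpM2l// mulr_ge0// ltW.
Qed.

End StarContinuity.

(** * The coarsest topology *)

Lemma nbhs_preimage (S T : topologicalType) (f : S -> T) (x : S) (B : set T) :
  {for x, continuous f} -> nbhs (f x) B -> nbhs x (f @^-1` B).
Proof. by move=> fx Bx; exact: fx. Qed.

(** Continuity of q^2 at 0 suffices at every point, as translations are continuous
for a locally convex topology. *)
Lemma open_ball_of_continuous_square (R : realType) (E : lmodType R[i])
    (t : Topological E) (q : E -> R[i]) (x : E) (e : R[i]) :
  let Et : topologicalType := Topological.Pack t in
  locally_convex_topology t -> seminorm q -> 0 < e ->
  continuous (fun y : Et => q y ^+ 2 : R[i]^o) ->
  nbhs (x : Et) [set y : Et | q ((y : E) - x) < e].
Proof.
move=> Et [t_add _ _] sq e0 q_cont; have [q0 _ _] := sq.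
have e20 : 0 < e ^+ 2 by rewrite exprn_gt0.
have sub_cont : continuous (fun y : Et => (y : E) - x : Et).
  move=> y; apply: (@continuous_comp Et (Et * Et)%type Et
    (fun y => (y, - x : E)) (fun z : Et * Et => (z.1 : E) + (z.2 : E) : Et)).
    by apply: cvg_pair; [exact: cvg_id|exact: cvg_cst].
  exact: t_add.
have comp_cont := continuous_comp (sub_cont (x : Et)) (q_cont _).
have xB := nbhs_preimage comp_cont (@nbhsx_ballx _ (R[i]^o) _ (e ^+ 2) e20).
apply: (@filterS Et (nbhs (x : Et)) (nbhs_filter (x : Et)) _ _ _ xB) => y /=.
rewrite -ball_normE /= subrr (seminorm0 sq) expr0n sub0r normrN.
rewrite ger0_norm ?exprn_ge0//.
by rewrite ltr_pXn2r ?nnegrE// ltW.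
Qed.

Section CoarsestTopology.
Variables (R : realType) (V : tvsType R[i]).
Local Notation C := R[i].

Lemma tscalar_continuous :
  let St : topologicalType := Topological.Pack (symtensor_topology V) in
  continuous (fun X : St => tscalar (X : symtensor V) : C^o).
Proof.
move=> St X A /nbhs_ballP[e /= e0 eA].
(* The bound on the scalar part holds for every form, in particular for 0. *)
pose h0 := fun _ _ : V => 0 : C; have h0_hilb : continuous_hilbert_form h0.
  exact: zero_hilbert_form.
apply/symtensor_ball_neighbourhoods; exists (fun Z : symtensor V => tnorm h0 Z), e.
split=> //; first by exists h0.
move=> Y Ye; apply: eA; rewrite -ball_normE /= distrC.
have h0_pos : hermitian_form h0 := h0_hilb.1.
have YE : symtensor_val Y = symtensor_val (Y - X) + symtensor_val X.
  by rewrite -[in LHS](subrK X Y).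
rewrite YE (linD (@tscalar_linear _ V)) addrK.
by apply: le_lt_trans Ye; exact: tscalar_le.
Qed.

Variable bar : {linear V -> V | conjC \; *:%R}.
Hypothesis bar_inv : involutive bar.
Hypothesis bar_cont : continuous bar.

Lemma bar_semilinear : GRing.linear_for (conjC \; *:%R) bar.
Proof. exact: linearP. Qed.

Lemma conj_form_hilbert h : continuous_hilbert_form h ->
  continuous_hilbert_form (conj_form bar h).
Proof.
move=> [h_pos h_cont]; split; first exact: (conj_form_hermitian bar_semilinear h_pos).
move=> [x y].
apply: (@continuous_comp _ _ _ (fun z : V * V => (bar z.2, bar z.1))
  (fun z : V * V => h z.1 z.2 : C^o)); last exact: h_cont.
apply: cvg_pair.
  by apply: (@continuous_comp _ _ _ snd bar); [exact: cvg_snd|exact: bar_cont].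
by apply: (@continuous_comp _ _ _ fst bar); [exact: cvg_fst|exact: bar_cont].
Qed.

Lemma tnorm_tstar h (X : tensor V) : positive_hermitian h ->
  tnorm h (tstar bar X) = tnorm (conj_form bar h) X.
Proof.
move=> h_pos; rewrite !tnormE /fnorm; congr sqrtC.
exact: (tensor_form_tensor_star bar_semilinear h_pos X).
Qed.

Lemma sstar_continuous :
  let St : topologicalType := Topological.Pack (symtensor_topology V) in
  continuous (sstar bar : St -> St).
Proof.
move=> St X A /symtensor_ball_neighbourhoods[_ [e [[h h_hilb ->] e0 hA]]].
apply/symtensor_ball_neighbourhoods.
exists (fun Z : symtensor V => tnorm (conj_form bar h) Z), e; split=> //.
  by exists (conj_form bar h); [exact: conj_form_hilbert|].
move=> Y Ye; apply: hA => /=.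
have sE : sstar bar Y - sstar bar X = sstar bar (Y - X).
  apply: val_inj; apply: (addIr (symtensor_val (sstar bar X))).
  by rewrite -[LHS]/(symtensor_val (sstar bar Y - sstar bar X + sstar bar X))
    subrK -[RHS]tstarD -[in LHS](subrK X Y).
have : tnorm h (symtensor_val (sstar bar (Y - X))) < e.
  by rewrite [tnorm _ _]tnorm_tstar//; exact: h_hilb.1.
by rewrite -sE; apply.
Qed.

Lemma Lambda_of_continuous h : continuous_form h ->
  continuous_form (Lambda_of bar h).
Proof.
move=> h_cont [x y].
apply: (@continuous_comp _ _ _ (fun z : V * V => (bar z.1, z.2))
  (fun z : V * V => h z.1 z.2 : C^o)); last exact: h_cont.
apply: cvg_pair; last exact: cvg_snd.
by apply: (@continuous_comp _ _ _ fst bar); [exact: cvg_fst|exact: bar_cont].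
Qed.

Lemma Lambda_of_hermitian h : positive_hermitian h ->
  hermitian_bilinear bar (Lambda_of bar h).
Proof.
move=> h_pos; have h_herm : hermitian_form h := h_pos.
split; last first.
  by move=> v w; rewrite /Lambda_of bar_inv; exact: (form_conj h_herm).
split=> [w a x y|v a x y]; rewrite /Lambda_of.
  by rewrite bar_semilinear (formDl h_herm) (formZl h_herm) conjCK.
by rewrite (formDr h_herm) (formZr h_herm).
Qed.

Lemma star_Lambda_of h (X Y : symtensor V) : positive_hermitian h ->
  tscalar (star (Lambda_of bar h) (sstar bar X) Y) = tform h X Y.
Proof.
move=> h_pos; have [bil _] := Lambda_of_hermitian h_pos.
exact: (tscalar_star_tensor_star bar_semilinear bar_inv h_pos Y
  (erefl : symtensor_val (sstar bar X) = tensor_star bar X) bil).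
Qed.

(** The square norm is the composite of the operations given by star_Lambda_of. *)
Lemma tnorm_square_continuous (t : Topological (symtensor V)) h :
    operations_continuous bar t -> continuous_hilbert_form h ->
  let Et : topologicalType := Topological.Pack t in
  continuous (fun X : Et => tnorm h (symtensor_val X) ^+ 2 : C^o).
Proof.
move=> [t_star t_sstar t_scalar] [h_pos h_cont] Et.
rewrite (_ : (fun X : Et => tnorm h (symtensor_val X) ^+ 2 : C^o) =
    (fun X : Et => tscalar (symtensor_val (star (Lambda_of bar h) (sstar bar X) X)) : C^o)).
  move=> Y; apply: (@continuous_comp Et Et C^o
    (fun Y => star (Lambda_of bar h) (sstar bar Y) Y : Et)
    (fun Z => tscalar (Z : symtensor V))); last exact: t_scalar.
  apply: (@continuous_comp Et (Et * Et)%type Et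
    (fun Y => (sstar bar Y, Y) : Et * Et)
    (fun z => star (Lambda_of bar h) z.1 z.2)); last first.
    apply: t_star; first exact: Lambda_of_continuous.
    exact: Lambda_of_hermitian.
  by apply: cvg_pair; [exact: t_sstar|exact: cvg_id].
by apply/funext => X; rewrite star_Lambda_of// [LHS]sqrtCK.
Qed.

Lemma symtensor_topology_coarsest (t : Topological (symtensor V)) :
    locally_convex_topology t -> operations_continuous bar t ->
  forall A : set (symtensor V),
    @open (Topological.Pack (symtensor_topology V)) A ->
    @open (Topological.Pack t) A.
Proof.
move=> t_lc t_op A A_open; rewrite openE => X AX.
have /symtensor_ball_neighbourhoods[_ [e [[h h_hilb ->] e0 hA]]] :
    nbhs (X : Topological.Pack (symtensor_topology V)) A.
  by apply: open_nbhs_nbhs; split.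
have XB := open_ball_of_continuous_square X t_lc (seminorm_tnorm h_hilb.1) e0
  (tnorm_square_continuous t_op h_hilb).
apply: (@filterS (Topological.Pack t) (nbhs (X : Topological.Pack t))
  (nbhs_filter (X : Topological.Pack t)) _ A _ XB) => Y.
exact: hA.
Qed.

End CoarsestTopology.

Theorem theorem3p5 (R : realType) (V : tvsType R[i])
    (bar : {linear V -> V | conjC \; *:%R})
    (V_hausdorff : hausdorff_space V)
    (V_cofinal : hilbert_cofinal V)
    (bar_involutive : involutive bar)
    (bar_continuous : continuous bar) :
  [/\ locally_convex_topology (symtensor_topology V),
      operations_continuous bar (symtensor_topology V)
    & forall t : Topological (symtensor V),
        locally_convex_topology t -> operations_continuous bar t ->
        forall A : set (symtensor V),
          @open (Topological.Pack (symtensor_topology V)) A ->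
          @open (Topological.Pack t) A]
  /\
  forall h : V -> V -> R[i], continuous_hilbert_form h ->
    [/\ continuous_form (Lambda_of bar h),
        hermitian_bilinear bar (Lambda_of bar h)
      & forall X Y : symtensor V,
          tscalar (star (Lambda_of bar h) (sstar bar X) Y) = tform h X Y].
Proof.
split=> [|h [h_pos h_cont]].
  split; [exact: symtensor_locally_convex| |exact: symtensor_topology_coarsest].
  split; [|exact: sstar_continuous|exact: tscalar_continuous].
  by move=> Lam Lam_cont [Lam_bil _]; exact: star_continuous.
split; [exact: Lambda_of_continuous|exact: Lambda_of_hermitian|].
by move=> X Y; exact: star_Lambda_of.
Qed.
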